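(* Let $\mathbf{K}$ be a local field, and let $SL_n(\mathbf{K})$ act on the additive group $\mathcal{M}_{n,m}(\mathbf{K})$ of $n\times m$ matrices over $\mathbf{K}$ by left multiplication, $(g,A)\mapsto gA$ for $g\in SL_n(\mathbf{K})$ and $A\in\mathcal{M}_{n,m}(\mathbf{K})$. Then for all $n\geq 3$ and all $m\in\mathbb{N}$ the semi-direct product $SL_n(\mathbf{K})\ltimes\mathcal{M}_{n,m}(\mathbf{K})$ has Kazhdan's Property (T).
   Context: An absolute value on a field $\mathbf{K}$ is a function $x\mapsto |x|\in\mathbb{R}$ such that for all $x,y\in\mathbf{K}$: $|x|\geq 0$, with $|x|=0$ if and only if $x=0$; $|xy|=|x||y|$; and $|x+y|\leq |x|+|y|$. It defines a topology on $\mathbf{K}$ via the metric $d(x,y)=|x-y|$. A field $\mathbf{K}$ is a local field if it can be equipped with an absolute value for which $\mathbf{K}$ is locally compact and not discrete; $\mathbf{K}$ carries this topology. The semi-direct product $SL_n(\mathbf{K})\ltimes\mathcal{M}_{n,m}(\mathbf{K})$ is the set $SL_n(\mathbf{K})\times\mathcal{M}_{n,m}(\mathbf{K})$ with multiplication $(g,A)(h,B)=(gh,A+gB)$ and the product topology, where the matrix spaces have the topology induced from $\mathbf{K}$. For a (strongly continuous) unitary representation $(\pi,\mathcal{H})$ of a topological group $G$ on a Hilbert space, a subset $Q\subseteq G$ and a real number $\varepsilon>0$, a vector $\xi\in\mathcal{H}$ is $(Q,\varepsilon)$-invariant if $\sup_{x\in Q}\|\pi(x)\xi-\xi\|<\varepsilon\|\xi\|$.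 A topological group $G$ has Kazhdan's Property (T) (is a Kazhdan group) if there exist a compact subset $Q$ of $G$ and $\varepsilon>0$ such that whenever a unitary representation $\pi$ of $G$ has a $(Q,\varepsilon)$-invariant vector, $\pi$ has a non-zero invariant vector, i.e. a vector $\xi\neq 0$ with $\pi(g)\xi=\xi$ for all $g\in G$. *)

(* Defs.v *)
From HB Require Import structures.
From mathcomp Require Import all_boot all_order all_algebra complex.
From mathcomp Require Import all_classical all_reals all_analysis.

Set Implicit Arguments.
Unset Strict Implicit.
Unset Printing Implicit Defensive.

Import Order.TTheory GRing.Theory Num.Theory.
Import numFieldNormedType.Exports.

Local Open Scope classical_set_scope.
Local Open Scope ring_scope.

Record absolute_value (R : realType) (K : fieldType) := AbsoluteValue {
  absval :> K -> R;
  absval_ge0 : forall x, 0 <= absval x;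
  absval_eq0 : forall x, absval x = 0 <-> x = 0;
  absvalM : forall x y, absval (x * y) = absval x * absval y;
  absvalD : forall x y, absval (x + y) <= absval x + absval y
}.

(* An alias of [K], so that the topology can depend on the absolute value. *)
Definition valued_field (R : realType) (K : fieldType)
  (v : absolute_value R K) : Type := K.

Section ValuedField.
Context {R : realType} {K : fieldType} (v : absolute_value R K).
Local Notation F := (valued_field v).

HB.instance Definition _ := GRing.Field.on F.

Definition absdist (x y : F) : R := v ((x : K) - y).

Lemma absval0 : v 0 = 0. Proof. exact/absval_eq0. Qed.

Lemma absval1 : v 1 = 1.
Proof.
have v1N0 : v 1 != 0 by apply/eqP => /absval_eq0/eqP; rewrite oner_eq0.
by apply: (mulfI v1N0); rewrite mulr1 -absvalM mulr1.
Qed.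

Lemma absvalN x : v (- x) = v x.
Proof.
have vN1 : v (-1) = 1.
  apply/eqP; rewrite -(@eqrXn2 _ 2) ?absval_ge0// expr1n expr2 -absvalM.
  by rewrite mulrNN mulr1 absval1.
by rewrite -mulN1r absvalM vN1 mul1r.
Qed.

Lemma absdistxx x : absdist x x = 0.
Proof. by rewrite /absdist subrr absval0. Qed.

Lemma absdist_eq0 x y : absdist x y = 0 -> x = y.
Proof. by move=> /absval_eq0 /eqP; rewrite subr_eq0 => /eqP. Qed.

Lemma absdist_sym x y : absdist x y = absdist y x.
Proof. by rewrite /absdist -absvalN opprB. Qed.

Lemma absdist_triangle y x z : absdist x z <= absdist x y + absdist y z.
Proof.
by apply: le_trans (absvalD v _ _); rewrite /absdist addrA subrK.
Qed.

HB.instance Definition _ := @isMetric.Build R F absdist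
  absdistxx absdist_eq0 absdist_sym absdist_triangle.

Lemma valued_field_cvgD (X : Type) (G : set_system X) (FG : Filter G)
    (f g : X -> F) (a b : F) :
  f @ G --> a -> g @ G --> b -> (fun x => f x + g x) @ G --> a + b.
Proof.
move=> /cvg_ballP fa /cvg_ballP gb; apply/cvg_ballP => e e0.
have e20 : 0 < e / 2 by rewrite divr_gt0.
near=> x.
have : absdist a (f x) < e / 2 by near: x; have := fa _ e20; rewrite ballEmdist.
have : absdist b (g x) < e / 2 by near: x; have := gb _ e20; rewrite ballEmdist.
rewrite ballEmdist /= /mdist /= /absdist => gx fx; rewrite [e]splitr.
apply: le_lt_trans (ltrD fx gx); rewrite opprD addrACA; exact: absvalD.
Unshelve. all: by end_near. Qed.

Lemma valued_field_cvgM (X : Type) (G : set_system X) (FG : Filter G)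
    (f g : X -> F) (a b : F) :
  f @ G --> a -> g @ G --> b -> (fun x => f x * g x) @ G --> a * b.
Proof.
move=> /cvg_ballP fa /cvg_ballP gb; apply/cvg_ballP => e e0.
pose M := 1 + v a + v b.
have M1 : 1 <= M by rewrite /M -addrA lerDl addr_ge0 ?absval_ge0.
have M0 : 0 < M by exact: lt_le_trans M1.
pose d := Num.min 1 (e / (M + M)).
have MM0 : 0 < M + M by exact: addr_gt0.
have d0 : 0 < d by rewrite lt_min ltr01 /= divr_gt0.
near=> x.
have : absdist a (f x) < d by near: x; have := fa _ d0; rewrite ballEmdist.
have : absdist b (g x) < d by near: x; have := gb _ d0; rewrite ballEmdist.
rewrite ballEmdist /= /mdist /= /absdist => gx fx.
have -> : (a * b : K) - f x * g x = (a - f x) * b + f x * (b - g x).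
  by rewrite mulrBl mulrBr addrA subrK.
have vf : v (f x) <= 1 + v a.
  have -> : f x = - ((a : K) - f x) + a by rewrite opprB subrK.
  apply: le_trans (absvalD v _ _) _; rewrite absvalN lerD2r.
  by rewrite (le_trans (ltW fx))// /d ge_min lexx.
apply: le_lt_trans (absvalD v _ _) _; rewrite !absvalM.
have dM : d * M + d * M <= e.
  by rewrite -mulrDr -(ler_pdivlMr _ _ MM0) /d ge_min lexx orbT.
apply: lt_le_trans dM; apply: ler_ltD.
  apply: ler_pM; rewrite ?absval_ge0// ?(ltW fx)//.
  by rewrite /M lerDr addr_ge0 ?absval_ge0.
rewrite mulrC; apply: (@le_lt_trans _ _ (v (b - g x) * M)).
  apply: ler_wpM2l; rewrite ?absval_ge0//.
  by rewrite (le_trans vf)// /M lerDl absval_ge0.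
by rewrite ltr_pM2r.
Unshelve. all: by end_near. Qed.

End ValuedField.

Definition local_field (R : realType) (K : fieldType)
    (v : absolute_value R K) : Prop :=
  locally_compact [set: valued_field v] /\
  ~ (forall A : set (valued_field v), open A).


Section MatrixConvergence.
Context {R : realType} {K : fieldType} (v : absolute_value R K).
Local Notation F := (valued_field v).
Variables (X : Type) (G : set_system X).
Context {FG : Filter G}.

Lemma mx_cvgP m n (f : X -> 'M[F]_(m, n)) (A : 'M[F]_(m, n)) :
  f @ G --> A <-> (forall i j, (fun x => f x i j) @ G --> A i j).
Proof.
split=> [fA i j B AB|fA B [P AP sPB]].
  apply: (fA [set M | B (M i j)]).
  exists (fun i' j' => [set y | (i' == i) && (j' == j) -> B y]) => [i' j'|M].
    case: (altP (i' =P i)) => [->|_] /=; last exact: filterE.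
    case: (altP (j' =P j)) => [->|_] /=; last exact: filterE.
    by apply: filterS AB => y By _.
  by move=> /(_ i j); apply; rewrite !eqxx.
suff : \forall x \near G, forall i j, P i j (f x i j).
  by apply: filterS => x Pf; exact: sPB.
apply: filter_forall => i; apply: filter_forall => j.
exact: fA (AP i j).
Qed.

Lemma valued_field_cvg_sum (I : Type) (r : seq I) (P : pred I)
    (f : I -> X -> F) (a : I -> F) :
  (forall i, f i @ G --> a i) ->
  (fun x => \sum_(i <- r | P i) f i x) @ G --> \sum_(i <- r | P i) a i.
Proof.
move=> fa; elim: r => [|i r IH].
  by under eq_fun do rewrite big_nil; rewrite big_nil; exact: cvg_cst.
under eq_fun do rewrite big_cons; rewrite big_cons.
by case: (P i) => //; exact: valued_field_cvgD.
Qed.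

Lemma valued_field_cvg_prod (I : Type) (r : seq I) (P : pred I)
    (f : I -> X -> F) (a : I -> F) :
  (forall i, f i @ G --> a i) ->
  (fun x => \prod_(i <- r | P i) f i x) @ G --> \prod_(i <- r | P i) a i.
Proof.
move=> fa; elim: r => [|i r IH].
  by under eq_fun do rewrite big_nil; rewrite big_nil; exact: cvg_cst.
under eq_fun do rewrite big_cons; rewrite big_cons.
by case: (P i) => //; exact: valued_field_cvgM.
Qed.

Lemma mx_cvgM m n p (f : X -> 'M[F]_(m, n)) (g : X -> 'M[F]_(n, p))
    (A : 'M[F]_(m, n)) (B : 'M[F]_(n, p)) :
  f @ G --> A -> g @ G --> B -> (fun x => f x *m g x) @ G --> A *m B.
Proof.
move=> /mx_cvgP fA /mx_cvgP gB; apply/mx_cvgP => i j; rewrite mxE.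
under eq_fun do rewrite mxE.
by apply: valued_field_cvg_sum => k; exact: valued_field_cvgM.
Qed.

Lemma mx_cvgD m n (f g : X -> 'M[F]_(m, n)) (A B : 'M[F]_(m, n)) :
  f @ G --> A -> g @ G --> B -> (fun x => f x + g x) @ G --> A + B.
Proof.
move=> /mx_cvgP fA /mx_cvgP gB; apply/mx_cvgP => i j; rewrite mxE.
under eq_fun do rewrite mxE.
exact: valued_field_cvgD.
Qed.

Lemma mx_cvgN m n (f : X -> 'M[F]_(m, n)) (A : 'M[F]_(m, n)) :
  f @ G --> A -> (fun x => - f x) @ G --> - A.
Proof.
move=> /mx_cvgP fA; apply/mx_cvgP => i j; rewrite mxE -mulN1r.
under eq_fun do rewrite mxE -mulN1r.
by apply: valued_field_cvgM => //; exact: cvg_cst.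
Qed.

Lemma mx_cvg_det n (f : X -> 'M[F]_n) (A : 'M[F]_n) :
  f @ G --> A -> (fun x => \det (f x)) @ G --> \det A.
Proof.
move=> /mx_cvgP fA; apply: valued_field_cvg_sum => s.
apply: valued_field_cvgM; first exact: cvg_cst.
exact: valued_field_cvg_prod.
Qed.

Lemma mx_cvg_adj n (f : X -> 'M[F]_n) (A : 'M[F]_n) :
  f @ G --> A -> (fun x => \adj (f x)) @ G --> \adj A.
Proof.
move=> /mx_cvgP fA; apply/mx_cvgP => i j; rewrite mxE.
under eq_fun do rewrite mxE.
apply: valued_field_cvgM; first exact: cvg_cst.
apply: mx_cvg_det; apply/mx_cvgP => k l; rewrite !mxE.
have -> : (fun x => row' j (col' i (f x)) k l) = (fun x => f x (lift j k) (lift i l)) by apply/funext => x; rewrite !mxE.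
exact: fA.
Qed.

End MatrixConvergence.

HB.mixin Record isTopologicalGroup G of Group G & Topological G := {
  mulg_continuous : continuous (fun x : G * G => (x.1 * x.2)%g);
  invg_continuous : continuous (fun x : G => (x^-1)%g)
}.

#[short(type="topologicalGroupType")]
HB.structure Definition TopologicalGroup :=
  { G of Group G & Topological G & isTopologicalGroup G }.


Section SpecialLinearGroup.
Variables (n : nat) (K : fieldType).

Record SL : Type := MkSL { SL_val :> 'M[K]_n; _ : \det SL_val == 1 }.

HB.instance Definition _ := [isSub for SL_val].
HB.instance Definition _ := [Choice of SL by <:].

Implicit Types g h : SL.

Lemma SL_det g : \det g = 1. Proof. by case: g => g /= /eqP. Qed.

Lemma SL_one_subproof : \det (1%:M : 'M[K]_n) == 1. Proof. by rewrite det1. Qed.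

Lemma SL_mul_subproof g h : \det (SL_val g *m SL_val h) == 1.
Proof. by rewrite det_mulmx !SL_det mulr1. Qed.

Lemma SL_inv_subproof g : \det (invmx g) == 1.
Proof. by rewrite det_inv SL_det invr1. Qed.

Definition SL_one := MkSL SL_one_subproof.
Definition SL_mul g h := MkSL (SL_mul_subproof g h).
Definition SL_inv g := MkSL (SL_inv_subproof g).

Lemma SL_unitmx g : (g : 'M[K]_n) \in unitmx.
Proof. by rewrite unitmxE SL_det unitr1. Qed.

Lemma SL_mulA : associative SL_mul.
Proof. by move=> x y z; apply: val_inj; rewrite /= mulmxA. Qed.

Lemma SL_mul1 : left_id SL_one SL_mul.
Proof. by move=> x; apply: val_inj; rewrite /= mul1mx. Qed.

Lemma SL_mulr1 : right_id SL_one SL_mul.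
Proof. by move=> x; apply: val_inj; rewrite /= mulmx1. Qed.

Lemma SL_mulV : left_inverse SL_one SL_inv SL_mul.
Proof. by move=> x; apply: val_inj; rewrite /= mulVmx ?SL_unitmx. Qed.

Lemma SL_mulrV : right_inverse SL_one SL_inv SL_mul.
Proof. by move=> x; apply: val_inj; rewrite /= mulmxV ?SL_unitmx. Qed.

HB.instance Definition _ :=
  isGroup.Build SL SL_mulA SL_mul1 SL_mulr1 SL_mulV SL_mulrV.

End SpecialLinearGroup.

Section SemidirectProduct.
Variables (n m : nat) (K : fieldType).

Definition SL_semidirect : Type := (SL n K * 'M[K]_(n, m))%type.

HB.instance Definition _ := Choice.on SL_semidirect.

Implicit Types x y : SL_semidirect.

Definition sd_one : SL_semidirect := (1%g, 0).
Definition sd_mul x y : SL_semidirect :=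
  ((x.1 * y.1)%g, x.2 + (x.1 : 'M[K]_n) *m y.2).
Definition sd_inv x : SL_semidirect :=
  ((x.1^-1)%g, - (((x.1^-1)%g : SL n K) : 'M[K]_n) *m x.2).

Lemma sd_mulA : associative sd_mul.
Proof.
move=> x y z; rewrite /sd_mul /= mulgA; congr pair.
by rewrite mulmxDr mulmxA addrA.
Qed.

Lemma sd_mul1 : left_id sd_one sd_mul.
Proof. by move=> [g A]; rewrite /sd_mul /= mul1g mul1mx add0r. Qed.

Lemma sd_mulr1 : right_id sd_one sd_mul.
Proof. by move=> [g A]; rewrite /sd_mul /= mulg1 mulmx0 addr0. Qed.

Lemma sd_mulV : left_inverse sd_one sd_inv sd_mul.
Proof. by move=> [g A]; rewrite /sd_mul /= mulVg mulNmx addNr. Qed.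

Lemma sd_mulrV : right_inverse sd_one sd_inv sd_mul.
Proof.
move=> [g A]; rewrite /sd_mul /= mulgV; congr pair.
by rewrite mulNmx mulmxN mulmxA mulmxV ?SL_unitmx// mul1mx subrr.
Qed.

HB.instance Definition _ := isGroup.Build SL_semidirect
  sd_mulA sd_mul1 sd_mulr1 sd_mulV sd_mulrV.

End SemidirectProduct.

Section SemidirectTopology.
Context {R : realType} {K : fieldType} (v : absolute_value R K).
Local Notation F := (valued_field v).
Variables n m : nat.

HB.instance Definition _ :=
  Topological.copy (SL n F) (initial_topology (@SL_val n F)).

HB.instance Definition _ :=
  Topological.copy (SL_semidirect n m F) (SL n F * 'M[F]_(n, m))%type.

Lemma SL_val_continuous : continuous (@SL_val n F).
Proof. exact: initial_continuous. Qed.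

Lemma SL_cvgP (X : Type) (G : set_system X) (FG : Filter G)
    (f : X -> SL n F) (g : SL n F) :
  (fun x => SL_val (f x)) @ G --> SL_val g -> f @ G --> g.
Proof.
move=> fg B /= [_ [[C oC <-] Cg sCB]].
have : nbhs (SL_val g) C by exact: open_nbhs_nbhs.
move=> /fg GC; apply: (@filterS _ G FG _ _ _ GC) => x; exact: sCB.
Qed.

Local Notation S := (SL_semidirect n m F).

Lemma sd_cvgP (X : Type) (G : set_system X) (FG : Filter G)
    (f : X -> S) (s : S) :
  (fun x => SL_val (f x).1) @ G --> SL_val s.1 ->
  (fun x => (f x).2 : 'M[F]_(n, m)) @ G --> s.2 -> f @ G --> s.
Proof.
move=> /(SL_cvgP FG (f := fun x => (f x).1)) f1 f2 B /= [[P Q] /= [Ps Qs] sPQ].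
have Pf := f1 _ Ps; have Qf := f2 _ Qs.
apply: (@filterS2 _ G FG _ _ _ _ Pf Qf) => x Px Qx.
exact: (sPQ (f x)).
Qed.

Lemma sd_val_continuous : continuous (fun x : S => SL_val x.1).
Proof.
move=> x; apply: (@continuous_comp S (SL n F) 'M[F]_n fst (@SL_val n F)).
  exact: cvg_fst.
exact: SL_val_continuous.
Qed.

Lemma sd_snd_continuous : continuous (fun x : S => x.2 : 'M[F]_(n, m)).
Proof. by move=> x; exact: cvg_snd. Qed.

Lemma sd_mul_continuous : continuous (fun x : S * S => (x.1 * x.2)%g).
Proof.
move=> x.
have c1 : (fun y : S * S => SL_val y.1.1) @ x --> SL_val x.1.1.
  exact: (@continuous_comp _ S _ fst _ x cvg_fst (@sd_val_continuous _)).
have c2 : (fun y : S * S => SL_val y.2.1) @ x --> SL_val x.2.1.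
  exact: (@continuous_comp _ S _ snd _ x cvg_snd (@sd_val_continuous _)).
have d1 : (fun y : S * S => y.1.2 : 'M[F]_(n, m)) @ x --> x.1.2.
  exact: (@continuous_comp _ S _ fst _ x cvg_fst (@sd_snd_continuous _)).
have d2 : (fun y : S * S => y.2.2 : 'M[F]_(n, m)) @ x --> x.2.2.
  exact: (@continuous_comp _ S _ snd _ x cvg_snd (@sd_snd_continuous _)).
apply: sd_cvgP; first exact: mx_cvgM.
by apply: mx_cvgD => //; exact: mx_cvgM.
Qed.

Lemma sd_inv_continuous : continuous (fun x : S => (x^-1)%g).
Proof.
move=> x.
have c1 : (fun y : S => invmx (SL_val y.1)) @ x --> invmx (SL_val x.1).
  have invE (g : SL n F) : invmx g = \adj g.
    by rewrite /invmx SL_unitmx SL_det invr1 scale1r.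
  rewrite invE; under eq_fun do rewrite invE.
  by apply: mx_cvg_adj; exact: sd_val_continuous.
apply: sd_cvgP => //.
apply: mx_cvgM; last exact: sd_snd_continuous.
exact: mx_cvgN.
Qed.

HB.instance Definition _ := isTopologicalGroup.Build (SL_semidirect n m F)
  sd_mul_continuous sd_inv_continuous.

End SemidirectTopology.

(* The inner product is linear in the first and conjugate-linear in the second
   argument; completeness is that of the norm it induces. *)
HB.mixin Record isHilbert (R : realType) H of CompleteNormedModule R[i] H := {
  hdot : {dot H for (@Num.conj R[i])};
  hdot_norm : forall x : H, hdot x x = `|x| ^+ 2
}.

#[short(type="hilbertType")]
HB.structure Definition Hilbert (R : realType) :=
  { H of CompleteNormedModule R[i] H & isHilbert R H }.

(* The norm of a normed space over [R[i]] takes values in [R[i]]. *)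
Definition hnorm (R : realType) (H : hilbertType R) (x : H) : R :=
  complex.Re `|x|.

Definition unitary_op (R : realType) (H : hilbertType R)
    (U : {linear H -> H}) : Prop :=
  range U = setT /\ forall x y : H, hdot (U x) (U y) = hdot x y.

Record unitary_rep (R : realType) (G : topologicalGroupType)
    (H : hilbertType R) := UnitaryRep {
  rep :> G -> {linear H -> H};
  rep1 : forall xi : H, rep 1%g xi = xi;
  repM : forall (x y : G) (xi : H), rep (x * y)%g xi = rep x (rep y xi);
  rep_unitary : forall x : G, unitary_op (rep x);
  rep_continuous : forall xi : H, continuous (fun x : G => rep x xi)
}.

(* The supremum is over a set bounded above by [2 * hnorm xi], so that [sup] is
   a genuine supremum (with value 0 when [Q] is empty). *)
Definition Qeps_invariant (R : realType) (G : topologicalGroupType)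
    (H : hilbertType R) (pi : unitary_rep G H) (Q : set G) (eps : R)
    (xi : H) : Prop :=
  sup [set hnorm (pi x xi - xi) | x in Q] < eps * hnorm xi.

Definition invariant_vector (R : realType) (G : topologicalGroupType)
    (H : hilbertType R) (pi : unitary_rep G H) (xi : H) : Prop :=
  forall g : G, pi g xi = xi.

Definition property_T (R : realType) (G : topologicalGroupType) : Prop :=
  exists (Q : set G) (eps : R), [/\ compact Q, 0 < eps &
    forall (H : hilbertType R) (pi : unitary_rep G H),
      (exists xi : H, Qeps_invariant pi Q eps xi) ->
      exists xi : H, xi != 0 /\ invariant_vector pi xi].

(* Main.v *)
From HB Require Import structures.
Require Import Defs.
From mathcomp Require Import all_boot all_order all_algebra complex.
From mathcomp Require Import all_classical all_reals all_analysis.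
From mathcomp Require Import ring lra.

(** (1) In SL_2(K) semidirect K^2, a unit vector x almost fixed by finitely many
    elementary matrices is almost fixed by a coordinate line of K^2, uniformly.  By
    (1), all elementary subgroups of the semidirect product move x by little;
    since they boundedly generate the group, the orbit of x stays in a small
    ball, and its circumcenter is a non-zero invariant vector.

    Property (1) is proved without spectral measures.  In the bicommutant of
    the translations let X and Y be weighted sums of |1 - U(lam^k a e_j)|^2 over
    the scales k, for the two coordinates j; spectrally they stand for a power
    of the two coordinates of a character.  The shear by t = lam^i fixes X and
    moves Y to Y_i, hence moves X / (X + Y + eps) to a_i = X / (X + Y_i + eps).
    Separating scales gives X <= small (Y_i + Y_j) up to an error supported on
    small scales, where x is almost fixed by continuity.  So the positive
    contractions a_i have almost orthogonal products a_i a_j, and the sum of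
    their values at the state x is at most about 1.  These values are all nearly
    equal, as x is almost fixed by the shears; with N shears each is O(1/N).
    Exchanging coordinates, (X + Y) / (X + Y + eps) is small at x, which means
    that x is almost fixed by the translations U(lam^k a e_1). *)

Set Implicit Arguments.
Unset Strict Implicit.
Unset Printing Implicit Defensive.

Import Order.TTheory GRing.Theory Num.Theory.
Import numFieldNormedType.Exports.

Local Open Scope ring_scope.

(** * Operators commuting with a unitary family *)

(** A real Hilbert space reduced to its form: no norm or topology is attached, and completeness is
    stated with squared distances, the only quantities used below. *)
Record hilbert_form (R : realType) (V : lmodType R) := HilbertForm {
  hform :> V -> V -> R;
  hformDl : forall x y z, hform (x + y) z = hform x z + hform y z;
  hformZl : forall a x z, hform (a *: x) z = a * hform x z;
  hformC : forall x y, hform x y = hform y x;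
  hform_ge0 : forall x, 0 <= hform x x;
  hform_eq0 : forall x, hform x x = 0 -> x = 0;
  hform_complete : forall u : nat -> V,
    (forall e, 0 < e -> exists N, forall m n, (N <= m)%N -> (N <= n)%N ->
       hform (u m - u n) (u m - u n) < e) ->
    exists l, forall e, 0 < e -> exists N, forall n, (N <= n)%N ->
       hform (u n - l) (u n - l) < e
}.

Section HilbertForm.
Context {R : realType} {V : lmodType R} (ip : hilbert_form V).
Implicit Types x y z : V.

Definition sqn x := ip x x.

Lemma ipDr x y z : ip x (y + z) = ip x y + ip x z.
Proof. by rewrite hformC hformDl !(hformC _ x). Qed.

Lemma ipZr a x y : ip x (a *: y) = a * ip x y.
Proof. by rewrite hformC hformZl hformC. Qed.

Lemma ipNl x y : ip (- x) y = - ip x y.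
Proof. by rewrite -scaleN1r hformZl mulN1r. Qed.

Lemma ipNr x y : ip x (- y) = - ip x y.
Proof. by rewrite hformC ipNl hformC. Qed.

Lemma ip0l x : ip 0 x = 0.
Proof. by rewrite -(scale0r 0) hformZl mul0r. Qed.

Definition ipE := (hformDl, ipDr, ipNl, ipNr, hformZl, ipZr).

Lemma sqn_ge0 x : 0 <= sqn x. Proof. exact: hform_ge0. Qed.

Lemma sqnN x : sqn (- x) = sqn x.
Proof. by rewrite /sqn !ipE opprK. Qed.

Lemma sqnBC x y : sqn (x - y) = sqn (y - x).
Proof. by rewrite -sqnN opprB. Qed.

Lemma sqnZ a x : sqn (a *: x) = a ^+ 2 * sqn x.
Proof. by rewrite /sqn !ipE mulrA. Qed.

Lemma parallelogram x y : sqn (x + y) + sqn (x - y) = 2 * sqn x + 2 * sqn y.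
Proof. by rewrite /sqn !ipE (hformC _ y x); ring. Qed.

Lemma sqnD_le x y : sqn (x + y) <= 2 * sqn x + 2 * sqn y.
Proof. by rewrite -parallelogram lerDl sqn_ge0. Qed.

Lemma sqnB_trans z x y : sqn (x - y) <= 2 * sqn (x - z) + 2 * sqn (z - y).
Proof. by rewrite -(subrKA z x); exact: sqnD_le. Qed.

Lemma ip_CS x y : ip x y ^+ 2 <= sqn x * sqn y.
Proof.
have [y0|yN0] := eqVneq (sqn y) 0.
  by rewrite (hform_eq0 y0) hformC ip0l /sqn ip0l mulr0 expr0n.
have yp : 0 < sqn y by rewrite lt_def yN0 sqn_ge0.
have := sqn_ge0 (sqn y *: x - ip x y *: y).
have -> : sqn (sqn y *: x - ip x y *: y) = sqn y * (sqn x * sqn y - ip x y ^+ 2).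
  by rewrite {1}/sqn !ipE (hformC _ y x) -/(sqn x) -/(sqn y); ring.
by rewrite pmulr_rge0// subr_ge0.
Qed.

(** Points chosen in [P] at tolerance 1/(n+1) form a Cauchy sequence, whose limit is [c]. This
    serves twice: to solve an equation that is approximately solvable, and to find a
    circumcenter. *)
Lemma cauchy_family_center (P : R -> V -> Prop) :
  (forall d, 0 < d -> exists x, P d x) ->
  (forall d d' x, d <= d' -> P d x -> P d' x) ->
  (forall e, 0 < e -> exists2 d, 0 < d &
     forall x y, P d x -> P d y -> sqn (x - y) < e) ->
  exists c, forall e, 0 < e -> exists2 d, 0 < d &
     forall x, P d x -> sqn (x - c) < e.
Proof.
move=> Pex Pmono Psmall.
have /choice[u uP] : forall n : nat, exists x, P n.+1%:R^-1 x.
  by move=> n; apply: Pex; rewrite invr_gt0 ltr0n.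
have uPd d : 0 < d -> exists N, forall n, (N <= n)%N -> P d (u n).
  move=> d0; exists (Num.truncn d^-1) => n Nn; apply: Pmono (uP n).
  have d1 : 0 <= d^-1 by rewrite invr_ge0 ltW.
  rewrite invf_ple ?posrE ?ltr0n//; apply/ltW.
  by apply: lt_le_trans (truncnS_gt _) _; rewrite ler_nat ltnS.
have [e e0|c cP] := hform_complete (h := ip) (u := u).
  have [d d0 dP] := Psmall e e0; have [N NP] := uPd d d0.
  by exists N => m n Nm Nn; apply: dP; exact: NP.
exists c => e e0; have e40 : 0 < e / 4 by rewrite divr_gt0.
have [d d0 dP] := Psmall _ e40; exists d => // x Px.
have [N1 N1P] := uPd d d0; have [N2 N2P] := cP _ e40.
have h1 := dP x _ Px (N1P _ (leq_maxl N1 N2)).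
have h2 := N2P _ (leq_maxr N1 N2).
apply: le_lt_trans (sqnB_trans (u (maxn N1 N2)) _ _) _.
rewrite -/(sqn _) in h2; lra.
Qed.

End HilbertForm.

Record unitary_family (R : realType) (V : lmodType R) (ip : hilbert_form V)
    (W : zmodType) := UnitaryFamily {
  ufam :> W -> {linear V -> V};
  ufam0 : forall x, ufam 0 x = x;
  ufamD : forall v w x, ufam (v + w) x = ufam v (ufam w x);
  ufam_ip : forall w x y, ip (ufam w x) (ufam w y) = ip x y
}.

Section Operators.
Context {R : realType} {V : lmodType R} {ip : hilbert_form V} {W : zmodType}
  (U : unitary_family ip W).
Implicit Types (x y : V) (w : W).

Local Notation sqn := (sqn ip).

Lemma ufamC v w x : U v (U w x) = U w (U v x).
Proof. by rewrite -!ufamD addrC. Qed.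

Lemma ufamVK w x : U w (U (- w) x) = x.
Proof. by rewrite -ufamD subrr ufam0. Qed.

Lemma ufam_adj w x y : ip (U w x) y = ip x (U (- w) y).
Proof. by rewrite -{1}(ufamVK w y) ufam_ip. Qed.

Definition in_commutant (f : V -> V) := forall w x, f (U w x) = U w (f x).

(* Asking for membership in the bicommutant makes these operators commute with
   each other, and with their inverses. *)
Record sa_op := SaOp {
  op :> V -> V;
  op_sym : forall x y, ip (op x) y = ip x (op y);
  op_comm : forall f : {linear V -> V}, in_commutant f ->
    forall x, f (op x) = op (f x)
}.

HB.instance Definition _ := gen_eqMixin sa_op.
HB.instance Definition _ := gen_choiceMixin sa_op.

Lemma sa_opP (S T : sa_op) : (forall x, S x = T x) -> S = T.
Proof.
case: S T => [f fs fc] [g gs gc] /= /funext fg.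
by case: g / fg in gs gc *; congr SaOp; exact: Prop_irrelevance.
Qed.

Lemma ip_ext x y : (forall z, ip x z = ip y z) -> x = y.
Proof.
move=> h; apply/eqP; rewrite -subr_eq0; apply/eqP/(hform_eq0 (h := ip)).
by rewrite !ipE; rewrite !h; ring.
Qed.

(** Moving [f] to the other side makes the pairing with any [z] linear, and the form separates
    points. Hence [sa_op] carries no linearity field. *)
Lemma sym_linear (f : V -> V) : (forall x y, ip (f x) y = ip x (f y)) ->
  linear f.
Proof. by move=> fs a x y; apply: ip_ext => z; rewrite !(fs, ipE). Qed.

HB.instance Definition _ (T : sa_op) :=
  GRing.isLinear.Build R V V _ (op T) (sym_linear (op_sym T)).

Lemma op_commutant (T : sa_op) : in_commutant T.
Proof. by move=> w x; rewrite op_comm// => v y; rewrite ufamC. Qed.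

Lemma opC (S T : sa_op) x : S (T x) = T (S x).
Proof. by rewrite op_comm//; exact: op_commutant. Qed.

Fact op0_sym x y : ip ((fun=> 0) x) y = ip x 0.
Proof. by rewrite (hformC _ x) !ip0l. Qed.
Fact op0_comm (f : {linear V -> V}) : in_commutant f ->
  forall x, f ((fun=> 0) x) = (fun=> 0) (f x).
Proof. by move=> _ x /=; rewrite linear0. Qed.
Definition op0 := SaOp op0_sym op0_comm.

Fact op1_comm (f : {linear V -> V}) : in_commutant f ->
  forall x, f (id x) = id (f x).
Proof. by []. Qed.
Definition op1 := SaOp (fun _ _ => erefl) op1_comm.

Fact opN_sym (T : sa_op) x y : ip ((fun x => - T x) x) y = ip x (- T y).
Proof. by rewrite ipNl ipNr op_sym. Qed.
Fact opN_comm (T : sa_op) (f : {linear V -> V}) : in_commutant f ->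
  forall x, f ((fun x => - T x) x) = (fun x => - T x) (f x).
Proof. by move=> fU x; rewrite linearN (op_comm T fU). Qed.
Definition opN T := SaOp (opN_sym T) (opN_comm T).

Fact opD_sym (S T : sa_op) x y :
  ip ((fun x => S x + T x) x) y = ip x (S y + T y).
Proof. by rewrite !ipE !op_sym. Qed.
Fact opD_comm (S T : sa_op) (f : {linear V -> V}) : in_commutant f ->
  forall x, f ((fun x => S x + T x) x) = (fun x => S x + T x) (f x).
Proof. by move=> fU x; rewrite linearD (op_comm S fU) (op_comm T fU). Qed.
Definition opD S T := SaOp (opD_sym S T) (opD_comm S T).

Fact opM_sym (S T : sa_op) x y : ip ((S \o T) x) y = ip x ((S \o T) y).
Proof. by rewrite /= !op_sym opC. Qed.
Fact opM_comm (S T : sa_op) (f : {linear V -> V}) : in_commutant f ->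
  forall x, f ((S \o T) x) = (S \o T) (f x).
Proof. by move=> fU x; rewrite /= (op_comm S fU) (op_comm T fU). Qed.
Definition opM S T := SaOp (opM_sym S T) (opM_comm S T).

Fact opDA : associative opD.
Proof. by move=> S T Q; apply: sa_opP => x /=; rewrite addrA. Qed.
Fact opDC : commutative opD.
Proof. by move=> S T; apply: sa_opP => x /=; rewrite addrC. Qed.
Fact op0D : left_id op0 opD.
Proof. by move=> S; apply: sa_opP => x /=; rewrite add0r. Qed.
Fact opND : left_inverse op0 opN opD.
Proof. by move=> S; apply: sa_opP => x /=; rewrite addNr. Qed.
HB.instance Definition _ := GRing.isZmodule.Build sa_op opDA opDC op0D opND.

Fact opMA : associative opM.
Proof. by move=> S T Q; apply: sa_opP. Qed.
Fact opMC : commutative opM.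
Proof. by move=> S T; apply: sa_opP => x; exact: opC. Qed.
Fact op1M : left_id op1 opM.
Proof. by move=> S; apply: sa_opP. Qed.
Fact opMDl : left_distributive opM opD.
Proof. by move=> S T Q; apply: sa_opP. Qed.
HB.instance Definition _ :=
  GRing.Zmodule_isComPzRing.Build sa_op opMA opMC op1M opMDl.

Fact scal_sym (a : R) x y : ip (a *: x) y = ip x (a *: y).
Proof. by rewrite !ipE. Qed.
Fact scal_comm (a : R) (f : {linear V -> V}) : in_commutant f ->
  forall x, f (( *:%R a) x) = a *: f x.
Proof. by move=> _ x; rewrite linearZ. Qed.
(** Scalars enter as elements of the commutative ring [sa_op], through a ring morphism, so that
    [ring] proves the operator identities below. *)
Definition scal (a : R) := SaOp (scal_sym a) (scal_comm a).

Fact scal_is_zmod_morphism : zmod_morphism scal.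
Proof. by move=> a b; apply: sa_opP => x /=; rewrite scalerBl. Qed.
Fact scal_is_monoid_morphism : monoid_morphism scal.
Proof.
by split=> [|a b]; apply: sa_opP => x /=; rewrite ?scale1r ?scalerA.
Qed.
HB.instance Definition _ :=
  GRing.isZmodMorphism.Build R sa_op scal scal_is_zmod_morphism.
HB.instance Definition _ :=
  GRing.isMonoidMorphism.Build R sa_op scal scal_is_monoid_morphism.

Definition state x (T : sa_op) := ip (T x) x.

Lemma stateD x S T : state x (S + T) = state x S + state x T.
Proof. exact: hformDl. Qed.
Lemma stateN x T : state x (- T) = - state x T.
Proof. exact: ipNl. Qed.
Lemma stateB x S T : state x (S - T) = state x S - state x T.
Proof. by rewrite stateD stateN. Qed.
Lemma stateZ x a T : state x (scal a * T) = a * state x T.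
Proof. exact: hformZl. Qed.
Lemma state1 x : state x 1 = sqn x.
Proof. by []. Qed.
Lemma state_scal x a : state x (scal a) = a * sqn x.
Proof. exact: hformZl. Qed.
Lemma state0 x : state x 0 = 0.
Proof. exact: ip0l. Qed.
Lemma stateM x S T : state x (S * T) = ip (T x) (S x).
Proof. exact: (op_sym S (T x) x). Qed.

Lemma state_sum x (I : Type) (r : seq I) (P : pred I) (F : I -> sa_op) :
  state x (\sum_(i <- r | P i) F i) = \sum_(i <- r | P i) state x (F i).
Proof. exact: (big_morph _ (stateD x) (state0 x)). Qed.

Lemma state_CS x T : state x T ^+ 2 <= state x (T ^+ 2) * sqn x.
Proof. by rewrite expr2 stateM; exact: ip_CS. Qed.

(* A product of commuting positive operators is positive, but this needs
   square roots; asking for positivity against every commuting positive [S]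
   makes stability under product immediate. *)
Definition pos (T : sa_op) := forall S : {linear V -> V}, in_commutant S ->
  (forall x y, ip (S x) y = ip x (S y)) -> (forall x, 0 <= ip (S x) x) ->
  forall x, 0 <= ip (T (S x)) x.

Lemma state_ge0 T x : pos T -> 0 <= state x T.
Proof.
by move=> Tp; apply: (Tp idfun) => // y; exact: hform_ge0.
Qed.

Lemma state_le S T x : pos (T - S) -> state x S <= state x T.
Proof. by move=> /(state_ge0 x); rewrite stateB subr_ge0. Qed.

Lemma pos0 : pos 0.
Proof. by move=> S SU Ss Sp x; rewrite ip0l. Qed.

Lemma posD S T : pos S -> pos T -> pos (S + T).
Proof.
move=> Sp Tp Q QU Qs Qp x; rewrite hformDl addr_ge0//; first exact: Sp.
exact: Tp.
Qed.

(** If [Q] is a test operator for the product, then [T \o Q] is one for [S]: it is symmetric because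
    the two commute, and positive because [T] is [pos]. *)
Lemma posM S T : pos S -> pos T -> pos (S * T).
Proof.
move=> Sp Tp Q QU Qs Qp x; have /= h := Sp (op T \o Q).
apply: (h _ _ _ x) => {x} [w x|x y|x] /=.
- by rewrite QU op_commutant.
- by rewrite op_sym Qs op_comm.
- exact: Tp.
Qed.

Lemma pos_scal a : 0 <= a -> pos (scal a).
Proof. by move=> a0 S SU Ss Sp x; rewrite hformZl mulr_ge0. Qed.

Lemma pos_sum (I : Type) (r : seq I) (P : pred I) (F : I -> sa_op) :
  (forall i, P i -> pos (F i)) -> pos (\sum_(i <- r | P i) F i).
Proof. by move=> h; apply: (big_ind pos) => //; [exact: pos0|exact: posD]. Qed.

(** Put y = T x, so that x = S y; the value to be bounded becomes [ip (S (Q y)) y]. *)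
Lemma pos_inv S T : S * T = 1 -> pos S -> pos T.
Proof.
move=> ST Sp Q QU Qs Qp x.
have STe z : S (T z) = z by rewrite -[LHS]/((S * T) z) ST.
rewrite -{2}(STe x) -op_sym STe -{1}(STe x) (op_comm S QU); exact: Sp.
Qed.

Fact lap_sym w x y :
  ip ((fun x => 2 *: x - U w x - U (- w) x) x) y =
  ip x (2 *: y - U w y - U (- w) y).
Proof. by rewrite /= !ipE !ufam_adj opprK; ring. Qed.
Fact lap_comm w (f : {linear V -> V}) : in_commutant f ->
  forall x, f ((fun x => 2 *: x - U w x - U (- w) x) x) =
    (fun x => 2 *: x - U w x - U (- w) x) (f x).
Proof. by move=> fU x; rewrite /= !linearB linearZ /= !fU. Qed.
(* This is |1 - U w| ^ 2. *)
Definition lap w := SaOp (lap_sym w) (lap_comm w).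

End Operators.

(** Bernoulli's inequality for [q^-1 = 1 + h]. *)
Lemma geometric_lt (R : realType) (q e : R) : 0 <= q < 1 -> 0 < e ->
  exists n, forall m, (n <= m)%N -> q ^+ m < e.
Proof.
move=> /andP[q0 q1] e0.
have [->|qN0] := eqVneq q 0.
  by exists 1%N => -[|m] // _; rewrite expr0n.
have qp : 0 < q by rewrite lt_def qN0.
pose h := q^-1 - 1.
have h0 : 0 < h by rewrite subr_gt0 invf_gt1.
have bern n : 1 + h *+ n <= q^-1 ^+ n.
  elim: n => [|n IH]; first by rewrite mulr0n addr0 expr0.
  rewrite exprS; apply: le_trans (_ : q^-1 * (1 + h *+ n) <= _); last first.
    by rewrite ler_pM2l ?invr_gt0.
  have -> : q^-1 = 1 + h by rewrite /h addrC subrK.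
  have hh : 0 <= h * (h *+ n) by rewrite mulr_ge0 ?mulrn_wge0 ?ltW.
  rewrite mulrS; set z := h *+ n in hh *; lra.
exists (Num.truncn (e^-1 / h)).+1 => m nm.
have : e^-1 < q^-1 ^+ m.
  apply: lt_le_trans (bern m); rewrite -mulr_natr addrC.
  apply: lt_le_trans (_ : h * m%:R <= _); last by rewrite lerDl.
  rewrite mulrC -ltr_pdivrMr//.
  by apply: lt_le_trans (truncnS_gt _) _; rewrite ler_nat.
by rewrite exprVn ltf_pV2 ?posrE ?exprn_gt0.
Qed.

Section Laplacians.
Context {R : realType} {V : lmodType R} {ip : hilbert_form V} {W : zmodType}
  {U : unitary_family ip W}.
Implicit Types (x y : V) (v w : W) (S T : sa_op U).

Local Notation sqn := (sqn ip).
Local Notation lap := (lap U).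

Lemma ip_lap w (f : {linear V -> V}) x : in_commutant U f ->
  ip (lap w (f x)) x = ip (f (x - U w x)) (x - U w x).
Proof.
move=> fU; rewrite linearB /= fU !ipE ufam_ip (ufam_adj _ (- w)) opprK.
ring.
Qed.

Lemma pos_lap w : pos (lap w).
Proof. by move=> S SU Ss Sp x; rewrite ip_lap. Qed.

(** The difference is |1 + U w|^2, so [S] is tested on [x + U w x]. *)
Lemma pos_lap_le4 w : pos (scal U 4 - lap w).
Proof.
move=> S SU Ss Sp x; have := Sp (x + U w x).
rewrite linearD /= SU !ipE ufam_ip (ufam_adj _ (- w)) opprK.
by congr (0 <= _); ring.
Qed.

Lemma lapN w : lap (- w) = lap w.
Proof. by apply: sa_opP => x /=; rewrite opprK addrAC. Qed.

Lemma psd_parallelogram (f : {linear V -> V}) x y :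
  (forall x, 0 <= ip (f x) x) ->
  ip (f (x + y)) (x + y) <= 2 * ip (f x) x + 2 * ip (f y) y.
Proof.
move=> fp; rewrite -subr_ge0; have := fp (x - y).
rewrite !linearB !linearD /= !ipE; congr (0 <= _); ring.
Qed.

(** From 1 - U(v + w) = (1 - U v) + U v (1 - U w) and the parallelogram inequality for the positive
    form of [S]. *)
Lemma pos_lapD v w : pos (scal U 2 * lap v + scal U 2 * lap w - lap (v + w)).
Proof.
move=> S SU Ss Sp x; rewrite hformDl ipNl hformDl !hformZl !ip_lap//.
have -> : x - U (v + w) x = (x - U v x) + U v (x - U w x).
  by rewrite ufamD linearB /= addrA subrK.
rewrite subr_ge0; apply: le_trans (psd_parallelogram _ _ _) _ => //.
by rewrite SU ufam_ip.
Qed.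

Lemma state_lap w x : state x (lap w) = sqn (x - U w x).
Proof. exact: (ip_lap w (f := idfun)). Qed.

Lemma state_lapM w x T : state x (lap w * T) = state (x - U w x) T.
Proof. by rewrite /state -(ip_lap w (f := op T))//; exact: op_commutant. Qed.

Lemma stateD_le x y T : pos T ->
  state (x + y) T <= 2 * state x T + 2 * state y T.
Proof. by move=> Tp; apply: psd_parallelogram => z; exact: state_ge0. Qed.

Lemma sqn_op_le T b x : pos T -> pos (scal U b - T) ->
  sqn (T x) <= b * state x T.
Proof.
move=> Tp Tb; have -> : sqn (T x) = state x (T * T) by rewrite stateM.
rewrite -stateZ; apply: state_le.
have -> : scal U b * T - T * T = T * (scal U b - T) by ring.
exact: posM.
Qed.

Lemma state_le_sqn T b x : pos (scal U b - T) -> state x T <= b * sqn x.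
Proof. by move=> /(state_le x); rewrite state_scal. Qed.

Lemma sqn_op_bound T b x : 0 <= b -> pos T -> pos (scal U b - T) ->
  sqn (T x) <= b ^+ 2 * sqn x.
Proof.
move=> b0 Tp Tb; apply: le_trans (sqn_op_le x Tp Tb) _.
by rewrite expr2 -mulrA ler_wpM2l// state_le_sqn.
Qed.

(** * Inverting a positive operator shifted by [eps] *)

Section Inverse.
Variables (T : sa_op U) (b eps : R).
Hypotheses (b0 : 0 <= b) (Tp : pos T) (Tb : pos (scal U b - T)) (e0 : 0 < eps).

Let B := T + scal U eps.
Let k := (b + eps)^-1.
Let be0 : 0 < b + eps. Proof. exact: ltr_wpDl. Qed.

Let posB : pos B.
Proof. by apply: posD => //; apply: pos_scal; exact: ltW. Qed.

Let B_coercive x : eps ^+ 2 * sqn x <= sqn (B x).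
Proof.
have -> : sqn (B x) = state x (B * B) by rewrite stateM.
rewrite -(state_scal U); apply: state_le.
have -> : B * B - scal U (eps ^+ 2) = T * T + scal U (2 * eps) * T.
  by rewrite /B; ring.
apply: posD; first exact: posM.
by apply: posM => //; apply: pos_scal; rewrite mulr_ge0// ltW.
Qed.

Let B_bound x : sqn (B x) <= (b + eps) ^+ 2 * sqn x.
Proof.
apply: sqn_op_bound => //; first exact: ltW.
by have -> : scal U (b + eps) - B = scal U b - T by rewrite /B; ring.
Qed.

(** Iterate x -> x - k (B x - y): each step multiplies the residual by [C = 1 - k B = k (b - T)],
    whose norm is at most k b < 1. *)
Let B_residual y d : 0 < d -> exists x, sqn (B x - y) < d.
Proof.
move=> d0; pose C := scal U k * (scal U b - T).
have CE : C = 1 - scal U k * B.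
  rewrite /C /B; have -> : 1 = scal U k * scal U (b + eps).
    by rewrite -rmorphM /k mulVf ?rmorph1// gt_eqF.
  by ring.
have k0 : 0 <= k by rewrite invr_ge0 ltW.
have Cc x : sqn (C x) <= (k * b) ^+ 2 * sqn x.
  apply: sqn_op_bound; first by rewrite mulr_ge0.
    by apply: posM => //; exact: pos_scal.
  have -> : scal U (k * b) - C = scal U k * T by rewrite /C; ring.
  by apply: posM => //; exact: pos_scal.
set q := (k * b) ^+ 2 in Cc.
have q01 : 0 <= q < 1.
  rewrite /q sqr_ge0 /= expr_lt1// ?mulr_ge0// /k mulrC ltr_pdivrMr// mul1r.
  by rewrite ltrDl.
have step n : exists x, sqn (B x - y) <= q ^+ n * sqn y.
  elim: n => [|n [x IH]].
    by exists 0; rewrite expr0 mul1r linear0 sub0r sqnN.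
  exists (x - k *: (B x - y)).
  have -> : B (x - k *: (B x - y)) - y = C (B x - y).
    rewrite CE -[RHS]/((B x - y) - k *: (B (B x - y))).
    by rewrite [B (x - _)]linearB linearZ /= addrAC.
  apply: le_trans (Cc _) _; rewrite exprS -mulrA ler_wpM2l//.
  by case/andP: q01.
have [|n nP] := geometric_lt (e := d / (sqn y + 1)) q01.
  by rewrite divr_gt0// ltr_wpDl// sqn_ge0.
have [x xP] := step n; exists x; apply: le_lt_trans xP _.
have y0 : 0 <= sqn y := sqn_ge0 _ _.
apply: (@le_lt_trans _ _ (q ^+ n * (sqn y + 1))).
  by rewrite ler_wpM2l ?lerDl// exprn_ge0//; case/andP: q01.
by rewrite -ltr_pdivlMr ?nP// ltr_wpDl.
Qed.

(** Coercivity makes points of small residual close to each other, and boundedness of [B] makes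
    their center an exact solution. *)
Let B_surj y : exists x, B x = y.
Proof.
have [||e e'0|c cP] :=
    @cauchy_family_center _ _ ip (fun d x => sqn (B x - y) < d).
- exact: B_residual.
- by move=> d d' x dd' /lt_le_trans; apply.
- exists (eps ^+ 2 * e / 4); first by rewrite divr_gt0// mulr_gt0// exprn_gt0.
  move=> x x' h h'; rewrite -(ltr_pM2l (_ : 0 < eps ^+ 2)) ?exprn_gt0//.
  apply: le_lt_trans (B_coercive _) _; rewrite linearB /=.
  by apply: le_lt_trans (sqnB_trans _ y _ _) _; rewrite (sqnBC _ y); lra.
exists c; apply/eqP; rewrite -subr_eq0; apply/eqP/(hform_eq0 (h := ip)).
apply: le_anti; rewrite hform_ge0 andbT -/(sqn _).
apply/ler_addgt0Pr => e e'0; rewrite add0r.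
have M0 : 0 < (b + eps) ^+ 2 by rewrite exprn_gt0.
have [|d d0 dP] := cP (e / (4 * (b + eps) ^+ 2)).
  by rewrite divr_gt0// mulr_gt0.
have [|x xP] := B_residual y (d := Num.min d (e / 4)).
  by rewrite lt_min d0 divr_gt0.
move: xP; rewrite lt_min => /andP[/dP xc xe].
apply: le_trans (sqnB_trans _ (B x) _ _) _.
have : sqn (B c - B x) <= e / 4.
  rewrite -linearB; apply: le_trans (B_bound _) _; rewrite sqnBC.
  rewrite mulrC -ler_pdivlMr//; apply/ltW/(lt_le_trans xc).
  by rewrite invfM mulrA.
lra.
Qed.

(** Symmetry and membership in the bicommutant pass from [B] to its set-theoretic inverse, which is
    unique by coercivity. *)
Lemma shifted_inverse : exists Q, (T + scal U eps) * Q = 1.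
Proof.
have /choice[f fP] := B_surj.
have Binj x y : B x = B y -> x = y.
  move=> xy; apply/eqP; rewrite -subr_eq0; apply/eqP/(hform_eq0 (h := ip)).
  have := B_coercive (x - y).
  have -> : B (x - y) = B x - B y := linearB B x y.
  rewrite xy subrr.
  have -> : sqn 0 = 0 by exact: ip0l.
  rewrite pmulr_rle0 ?exprn_gt0// => h.
  by apply: le_anti; rewrite h sqn_ge0.
have fsym x y : ip (f x) y = ip x (f y).
  by rewrite -{1}(fP y) -op_sym fP.
have fcomm (g : {linear V -> V}) : in_commutant U g -> forall x, g (f x) = f (g x).
  by move=> gU x; apply: Binj; rewrite fP -(op_comm B gU) fP.
by exists (SaOp fsym fcomm); apply: sa_opP => x; exact: fP.
Qed.

End Inverse.

End Laplacians.

(** * Inequalities between resolvents *)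

Section Resolvents.
Context {R : realType} {V : lmodType R} {ip : hilbert_form V} {W : zmodType}
  {U : unitary_family ip W}.
Implicit Types (x y : V) (v w : W) (S T : sa_op U).

Local Notation sqn := (sqn ip).
Local Notation lap := (lap U).
Local Notation scal := (scal U).

Lemma resolvent_compl (X Y Q : sa_op U) e : (X + Y + scal e) * Q = 1 ->
  1 - X * Q = (Y + scal e) * Q.
Proof. by move=> <-; ring. Qed.

Lemma resolvent_le1 (X Y Q : sa_op U) e : 0 < e -> pos X -> pos Y ->
  (X + Y + scal e) * Q = 1 -> pos (1 - X * Q).
Proof.
move=> e0 Xp Yp XYQ; rewrite (resolvent_compl XYQ).
have ep : pos (scal e) by apply: pos_scal; exact: ltW.
apply: posM; first exact: posD.
by apply: (pos_inv XYQ); do 2?apply: posD.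
Qed.

(** Both [X * Q] and [1 - X * Q] are positive, hence so is their product. *)
Lemma resolvent_sqr (X Y Q : sa_op U) e : 0 < e -> pos X -> pos Y ->
  (X + Y + scal e) * Q = 1 -> pos (X * Q - X * Q * (X * Q)).
Proof.
move=> e0 Xp Yp XYQ.
have -> : X * Q - X * Q * (X * Q) = X * Q * (1 - X * Q) by ring.
apply: posM; last exact: resolvent_le1 XYQ.
apply: posM => //; apply: (pos_inv XYQ).
by do 2?apply: posD => //; apply: pos_scal; exact: ltW.
Qed.

Lemma resolvent_norm (X Y Q : sa_op U) e : 0 < e -> pos X -> pos Y ->
  (X + Y + scal e) * Q = 1 -> pos (scal e^-1 - Q).
Proof.
move=> e0 Xp Yp XYQ.
have -> : scal e^-1 - Q = scal e^-1 * (X + Y) * Q.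
  have ee : scal e^-1 * scal e = 1 by rewrite -rmorphM mulVf ?rmorph1// gt_eqF.
  transitivity (scal e^-1 * ((X + Y + scal e) * Q) - (scal e^-1 * scal e) * Q).
    by rewrite XYQ ee mulr1 mul1r.
  by ring.
apply: posM; first by apply: posM; [apply: pos_scal; rewrite invr_ge0 ltW|exact: posD].
apply: (pos_inv XYQ).
by do 2?apply: posD => //; apply: pos_scal; exact: ltW.
Qed.

(** Multiply the last hypothesis by [X * Q * Q']. The factors X (Y + Y') Q Q', X Q and e X Q Q',
    which then accompany [t], [Z * Q'] and [f], are at most 1, as expanding the products in [BQ] and
    [BQ'] shows. *)
Lemma resolvent_cross (X Y Y' Z Q Q' : sa_op U) e t f :
    0 < e -> 0 <= t -> 0 <= f -> pos X -> pos Y -> pos Y' -> pos Z ->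
    (X + Y + scal e) * Q = 1 -> (X + Y' + scal e) * Q' = 1 ->
    pos (scal t * (Y + Y') + Z + scal f * scal e - X) ->
  pos (scal t + Z * Q' + scal f - X * Q * (X * Q')).
Proof.
move=> e0 t0 f0 Xp Yp Y'p Zp BQ BQ' Hp.
have ep : pos (scal e) by apply: pos_scal; exact: ltW.
have tp : pos (scal t) by exact: pos_scal.
have fp : pos (scal f) by exact: pos_scal.
have Qp : pos Q by apply: (pos_inv BQ); do 2?apply: posD.
have Q'p : pos Q' by apply: (pos_inv BQ'); do 2?apply: posD.
have -> : scal t + Z * Q' + scal f - X * Q * (X * Q') =
    scal t * (Q * Q' * (X * X + Y * Y' + scal e * (X + X + Y + Y' + scal e)))
    + Z * Q' * ((Y + scal e) * Q)
    + scal f * (Q * Q' * (X * X + X * Y' + Y * X + Y * Y' +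
         scal e * (Y + X + Y' + scal e)))
    + X * Q * Q' * (scal t * (Y + Y') + Z + scal f * scal e - X).
  have -> : scal t + Z * Q' + scal f - X * Q * (X * Q') =
    scal t * (((X + Y + scal e) * Q) * ((X + Y' + scal e) * Q')) +
    Z * Q' * ((X + Y + scal e) * Q) +
    scal f * (((X + Y + scal e) * Q) * ((X + Y' + scal e) * Q')) -
    X * Q * (X * Q').
    by rewrite BQ BQ' !mulr1.
  by ring.
by do ![assumption | apply: posD | apply: posM].
Qed.

(** [J] intertwines the two shifted sums, hence also their inverses. *)
Lemma state_resolvent_intertwine (X Y Q X' Y' Q' : sa_op U) e
    (J : {linear V -> V}) x :
  (forall x y, ip (J x) (J y) = ip x y) ->
  (forall x, J (X x) = X' (J x)) -> (forall x, J (Y x) = Y' (J x)) ->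
  (X + Y + scal e) * Q = 1 -> (X' + Y' + scal e) * Q' = 1 ->
  state (J x) (X' * Q') = state x (X * Q).
Proof.
move=> Jip JX JY BQ BQ'.
have JQ y : J (Q y) = Q' (J y).
  rewrite -[LHS]/((1 : sa_op U) (J (Q y))) -BQ' mulrC.
  rewrite -[LHS]/(Q' (X' (J (Q y)) + Y' (J (Q y)) + e *: J (Q y))).
  rewrite -JX -JY -linearZ -!linearD /=.
  by rewrite -[X (Q y) + _ + _]/(((X + Y + scal e) * Q) y) BQ.
rewrite -[LHS]/(ip (X' (Q' (J x))) (J x)) -JQ -JX Jip //.
Qed.

(** Almost orthogonality: for the sum m of the states, Cauchy-Schwarz gives m^2 <= m + N^2 k <= m +
    2, where m comes from the diagonal products and N^2 k from the others. Hence m <= 2. *)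
Lemma sum_state_le2 N (a : 'I_N -> sa_op U) k x : sqn x = 1 -> 0 <= k ->
  (forall i, state x (a i * a i) <= state x (a i)) ->
  (forall i j, i != j -> state x (a i * a j) <= k) ->
  N%:R ^+ 2 * k <= 2 -> \sum_i state x (a i) <= 2.
Proof.
move=> x1 k0 adiag aoff Nk; set m := \sum_i _.
have mm : m ^+ 2 <= m + N%:R ^+ 2 * k.
  have := state_CS x (\sum_i a i); rewrite x1 mulr1 state_sum -/m.
  move=> /le_trans; apply; rewrite expr2 mulr_suml state_sum.
  have -> : m + N%:R ^+ 2 * k = \sum_i (state x (a i) + N%:R * k).
    rewrite big_split /= -/m sumr_const card_ord -[(_ * k) *+ N]mulr_natl expr2.
    by rewrite mulrA.
  apply: ler_sum => i _; rewrite mulr_sumr state_sum (bigD1 i) //=.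
  apply: lerD; first exact: adiag.
  apply: le_trans (_ : \sum_(j < N | j != i) k <= _).
    by apply: ler_sum => j ji; apply: aoff; rewrite eq_sym.
  rewrite sumr_const -[k *+ _]mulr_natl ler_wpM2r// ler_nat.
  by rewrite -[leqRHS]card_ord max_card.
rewrite leNgt; apply/negP => m2; nra.
Qed.

Lemma state_sum_le n (T : sa_op U) (y : nat -> V) A : pos T ->
  (forall m, (m < n)%N -> state (y m) T <= A) ->
  state (\sum_(0 <= m < n) y m) T <= n%:R ^+ 2 * A.
Proof.
move=> Tp yA; rewrite /state linear_sum /= !big_mkord.
have ip_suml (I : finType) (f : I -> V) z :
  ip (\sum_m f m) z = \sum_m ip (f m) z.
  by apply: (big_morph (fun u => ip u z)) => [u w|]; rewrite ?hformDl ?ip0l.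
rewrite ip_suml.
(* Positivity of [T] at [y m - y l] bounds a cross term by the mean of two diagonal ones. *)
have cross m l : (m < n)%N -> (l < n)%N -> ip (T (y m)) (y l) <= A.
  move=> mn ln; have := state_ge0 (y m - y l) Tp.
  have TC : ip (T (y l)) (y m) = ip (T (y m)) (y l) by rewrite op_sym hformC.
  rewrite /state linearB /= !ipE TC.
  by have := yA m mn; have := yA l ln; rewrite /state; lra.
have -> : n%:R ^+ 2 * A = \sum_(0 <= m < n) \sum_(0 <= l < n) A.
  by rewrite !big_mkord !sumr_const card_ord -mulrnA -[A *+ _]mulr_natl natrM.
rewrite !big_mkord; apply: ler_sum => m _.
rewrite hformC ip_suml; apply: ler_sum => l _.
by rewrite hformC; exact: cross.
Qed.

(* From M(1 - U) = (1 - U^M) + \sum_(m < M) (1 - U)(1 - U^m). *)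
Lemma lap_mulrn_bound M (T : sa_op U) w x C k : (0 < M)%N -> pos T -> 0 <= C ->
  (forall m, (m < M)%N -> sqn (x - U (w *+ m) x) <= k) ->
  (forall y, state y (lap w * T) <= C * sqn y) ->
  state x (lap w * T) <=
    2 / M%:R ^+ 2 * state x (lap (w *+ M) * T) + 2 * C * k.
Proof.
move=> M0 Tp C0 xk TC.
pose y m := (x - U (w *+ m) x) - U w (x - U (w *+ m) x).
have yE n : (x - U w x) *+ n = (x - U (w *+ n) x) + \sum_(0 <= m < n) y m.
  elim: n => [|n IH]; first by rewrite big_geq// mulr0n ufam0 subrr addr0.
  rewrite mulrSr IH big_nat_recr //=.
  rewrite -[y n]/(x - U (w *+ n) x - U w (x - U (w *+ n) x)).
  rewrite (linearB (U w)) /= -ufamD -mulrS.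
  by apply: (ip_ext (ip := ip)) => z; rewrite !ipE; ring.
have yb m : (m < M)%N -> state (y m) T <= C * k.
  move=> mM; rewrite -state_lapM; apply: le_trans (TC _) _.
  by rewrite ler_wpM2l// xk.
have M2 : 0 < M%:R ^+ 2 :> R by rewrite exprn_gt0// ltr0n.
have := stateD_le (x - U (w *+ M) x) (\sum_(0 <= m < M) y m) Tp.
have := state_sum_le Tp yb; rewrite -yE -!state_lapM.
have -> : state ((x - U w x) *+ M) T = M%:R ^+ 2 * state x (lap w * T).
  by rewrite state_lapM -scaler_nat /state linearZ /= !ipE; ring.
set p := state x _; set q := state x _ => h1 h2.
rewrite -(ler_pM2l M2).
have -> : M%:R ^+ 2 * (2 / M%:R ^+ 2 * q + 2 * C * k) =
    2 * q + 2 * (M%:R ^+ 2 * (C * k)).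
  by field; rewrite pnatr_eq0 -lt0n.
lra.
Qed.

End Resolvents.

(** * Sums over scales *)

Section ScaleSums.
Context {R : realType} {V : lmodType R} {ip : hilbert_form V} {F : fieldType}
  {W : lmodType F} (U : unitary_family ip W).
Variables (lam : F) (c : R) (L : nat).
Implicit Types (x y : V) (u v : W).

Local Notation sqn := (sqn ip).
Local Notation lap := (lap U).
Local Notation scal := (scal U).

Hypothesis c4 : 4 <= c.

Let c0 : 0 < c. Proof. by apply: lt_le_trans c4; rewrite ltr0n. Qed.
Let ci0 k : 0 <= c^-1 ^+ k. Proof. by rewrite exprn_ge0 ?invr_ge0 ?ltW. Qed.
Let cN0 : c != 0. Proof. by rewrite gt_eqF. Qed.
Let ci1 k : c^-1 ^+ k <= 1.
Proof.
rewrite exprn_ile1 ?invr_ge0 ?(ltW c0)// invf_le1//.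
by apply: le_trans c4; rewrite ler1n.
Qed.

Definition scale_term u (k : nat) := scal (c^-1 ^+ k) * lap (lam ^+ k *: u).

Definition scale_sum u := \sum_(0 <= k < L.+1) scale_term u k.

(* The part of [scale_sum u] that the dilation by [lam ^+ q] does not reach. *)
Definition scale_head q u := \sum_(0 <= k < q) scale_term u k.

Lemma pos_scale_term u k : pos (scale_term u k).
Proof. by apply: posM; [exact: pos_scal|exact: pos_lap]. Qed.

Lemma pos_scale_sum u : pos (scale_sum u).
Proof. by apply: pos_sum => k _; exact: pos_scale_term. Qed.

Lemma pos_scale_head q u : pos (scale_head q u).
Proof. by apply: pos_sum => k _; exact: pos_scale_term. Qed.

Lemma scale_sum_term u k : (k <= L)%N ->
  pos (scale_sum u - scal (c^-1 ^+ k) * lap (lam ^+ k *: u)).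
Proof.
move=> kL; rewrite /scale_sum big_mkord (bigD1 (inord k)) //= inordK// addrC addrK.
by apply: pos_sum => i _; exact: pos_scale_term.
Qed.

Lemma scale_sum_bound u : exists2 b, 0 <= b & pos (scal b - scale_sum u).
Proof.
exists (\sum_(0 <= k < L.+1) c^-1 ^+ k * 4).
  by apply: sumr_ge0 => k _; rewrite mulr_ge0.
rewrite rmorph_sum -sumrB; apply: pos_sum => k _.
rewrite /scale_term rmorphM -mulrBr; apply: posM; [exact: pos_scal|exact: pos_lap_le4].
Qed.

Lemma scale_sumN u : scale_sum (- u) = scale_sum u.
Proof. by apply: eq_bigr => k _; rewrite /scale_term scalerN lapN. Qed.

Lemma scale_sumD u v :
  pos (scal 2 * scale_sum u + scal 2 * scale_sum v - scale_sum (u + v)).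
Proof.
rewrite !mulr_sumr -big_split -sumrB; apply: pos_sum => k _ /=.
rewrite /scale_term scalerDr; set A := lap _; set B := lap _; set D := lap (_ + _).
have -> : scal 2 * (scal (c^-1 ^+ k) * A) + scal 2 * (scal (c^-1 ^+ k) * B) -
  scal (c^-1 ^+ k) * D =
  scal (c^-1 ^+ k) * (scal 2 * A + scal 2 * B - D) by ring.
by apply: posM; [exact: pos_scal|exact: pos_lapD].
Qed.

(** Dilation by [lam ^+ q] shifts the scales by [q], which the weights turn into a factor [c ^+ q].
    The window loses its first [q] terms, the head, and gains [q] terms beyond [L]; these form [E],
    and their weights are at most [c^-1 ^+ L.+1]. *)
Lemma scale_sum_dilate q u : exists2 E,
  scale_sum (lam ^+ q *: u) =
    scal (c ^+ q) * (scale_sum u + E - scale_head q u) &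
  pos E /\ pos (scal (4 * q%:R * c^-1 ^+ L.+1) - E).
Proof.
exists (\sum_(0 <= k < q) scale_term u (k + L.+1)%N).
  have -> : scale_sum (lam ^+ q *: u) =
      scal (c ^+ q) * \sum_(0 <= k < L.+1) scale_term u (k + q)%N.
    rewrite mulr_sumr; apply: eq_bigr => k _; rewrite /scale_term.
    rewrite scalerA -exprD mulrA -rmorphM; congr (scal _ * _).
    by rewrite exprD mulrCA -exprMn divff// expr1n mulr1.
  congr (_ * _); apply/eqP; rewrite eq_sym subr_eq; apply/eqP.
  have shiftE a b : \sum_(0 <= k < a) scale_term u (k + b)%N =
      \sum_(b <= k < b + a) scale_term u k.
    by rewrite -{2}[b]add0n big_addn addKn.
  rewrite !shiftE -big_cat_nat//= ?leq_addr// [RHS]addrC -big_cat_nat//=.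
    by rewrite addnC.
  exact: leq_addr.
split; first by apply: pos_sum => k _; exact: pos_scale_term.
have -> : scal (4 * q%:R * c^-1 ^+ L.+1) =
    \sum_(0 <= k < q) scal (c^-1 ^+ L.+1) * scal 4.
  have -> : 4 * q%:R * c^-1 ^+ L.+1 = c^-1 ^+ L.+1 * 4 * q%:R by ring.
  rewrite sumr_const_nat subn0 -[RHS]mulr_natr -[q%:R in RHS](rmorph_nat scal).
  by rewrite -(rmorphM scal) -(rmorphM scal).
rewrite -sumrB; apply: pos_sum => k _.
rewrite /scale_term.
have -> : scal (c^-1 ^+ L.+1) * scal 4 -
    scal (c^-1 ^+ (k + L.+1)) * lap (lam ^+ (k + L.+1) *: u) =
  scal (c^-1 ^+ L.+1) * scal (1 - c^-1 ^+ k) * scal 4 +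
  scal (c^-1 ^+ (k + L.+1)) * (scal 4 - lap (lam ^+ (k + L.+1) *: u)).
  by rewrite exprD; ring.
apply: posD; last by apply: posM; [exact: pos_scal|exact: pos_lap_le4].
apply: posM; last exact: pos_scal.
apply: posM; apply: pos_scal => //.
by rewrite subr_ge0.
Qed.

Lemma scale_head_mono p q u : (p <= q)%N -> pos (scale_head q u - scale_head p u).
Proof.
move=> pq; rewrite /scale_head (big_cat_nat (leq0n p) pq) /= addrAC subrr add0r.
by apply: pos_sum => k _; exact: pos_scale_term.
Qed.

(** The two sheared vectors differ by [(lam ^+ i - lam ^+ j) *: u1], so their sums control the sum
    at this vector, hence the one at [lam ^+ i *: u1] up to the one at [lam ^+ j *: u1]. By dilation
    the last two are about c^i X and c^j X, and for j < i the first dominates. *)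
Lemma shear_separation N i j u1 u2 : (j < i)%N -> (i < N)%N ->
  pos (scal (8 / c) * (scale_sum (u2 + lam ^+ i *: u1) +
                       scale_sum (u2 + lam ^+ j *: u1))
       + scal 2 * scale_head N u1 + scal (4 * N%:R * c^-1 ^+ L.+1)
       - scale_sum u1).
Proof.
move=> ji iN; set Yi := scale_sum (_ + lam ^+ i *: _).
set Yj := scale_sum (_ + lam ^+ j *: _); set X := scale_sum u1.
have [Ei XiE [Eip _]] := scale_sum_dilate i u1.
have [Ej XjE [Ejp Ejb]] := scale_sum_dilate j u1.
set Zi := scale_head i u1 in XiE; set Zj := scale_head j u1 in XjE.
set Z := scale_head N u1.
pose A := scale_sum ((lam ^+ i - lam ^+ j) *: u1).
have D1 : pos (scal 2 * Yi + scal 2 * Yj - A).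
  have := scale_sumD (u2 + lam ^+ i *: u1) (- (u2 + lam ^+ j *: u1)).
  rewrite scale_sumN -/Yi -/Yj; congr (pos (_ - scale_sum _)).
  by rewrite opprD addrACA subrr add0r -scalerBl.
have D2 : pos (scal 2 * A + scal 2 * (scal (c ^+ j) * (X + Ej - Zj))
            - scal (c ^+ i) * (X + Ei - Zi)).
  rewrite -XiE -XjE; have := scale_sumD ((lam ^+ i - lam ^+ j) *: u1) (lam ^+ j *: u1).
  by rewrite -scalerDl subrK.
pose al := c^-1 ^+ i; pose be := c^-1 ^+ (i - j).
have al0 : 0 <= al by exact: ci0.
have be0 : 0 <= be by exact: ci0.
have al1 : al <= c^-1.
  rewrite /al -(prednK (leq_ltn_trans (leq0n j) ji)) exprS.
  by rewrite ler_piMr ?ci1 ?invr_ge0 ?(ltW c0).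
have be1 : be <= c^-1.
  rewrite /be; move: ji; rewrite -subn_gt0 => /prednK <-; rewrite exprS.
  by rewrite ler_piMr ?ci1 ?invr_ge0 ?(ltW c0).
have c14 : c^-1 <= 4^-1 by rewrite lef_pV2 ?posrE.
have ali : scal al * scal (c ^+ i) = 1.
  by rewrite -rmorphM /al -exprMn mulVf// expr1n rmorph1.
have alj : scal al * scal (c ^+ j) = scal be.
  rewrite -rmorphM /al /be -{1}(subnK (ltnW ji)) exprD -mulrA -exprMn mulVf//.
  by rewrite expr1n mulr1.
(* Multiplying [D2] by [2 * al] bounds 2 X. The term [4 * be * X] on the other side is at most X,
   since [be <= c^-1 <= 4^-1], and [4 * al * A] is at most [8 * al * (Yi + Yj)] by [D1]. The
   summands below record the slack. *)
have -> : scal (8 / c) * (Yi + Yj) + scal 2 * Z + scal (4 * N%:R * c^-1 ^+ L.+1) - X =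
    scal (2 * al) * (scal 2 * A + scal 2 * (scal (c ^+ j) * (X + Ej - Zj))
            - scal (c ^+ i) * (X + Ei - Zi))
    + scal (4 * al) * (scal 2 * Yi + scal 2 * Yj - A)
    + scal (8 * (c^-1 - al)) * (Yi + Yj)
    + scal 2 * (Z - Zi) + scal (4 * be) * Zj + scal 2 * Ei
    + scal (1 - 4 * be) * X
    + scal (4 * (N%:R - j%:R) * c^-1 ^+ L.+1)
    + scal (1 - 4 * be) * scal (4 * j%:R * c^-1 ^+ L.+1)
    + scal (4 * be) * (scal (4 * j%:R * c^-1 ^+ L.+1) - Ej).
  have alj' : scal (2 * al) * (scal 2 * (scal (c ^+ j) * (X + Ej - Zj))) =
    scal (4 * be) * (X + Ej - Zj).
    by rewrite [scal (4 * be)]rmorphM /= -alj; ring.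
  have ali' : scal (2 * al) * (scal (c ^+ i) * (X + Ei - Zi)) =
    scal 2 * (X + Ei - Zi).
    by rewrite [scal (2 * al)]rmorphM /= -mulrA [scal al * _]mulrA ali mul1r.
  rewrite [scal (2 * al) * (_ - _)]mulrBr [scal (2 * al) * (_ + _)]mulrDr.
  by rewrite alj' ali'; ring.
have pX : pos X by exact: pos_scale_sum.
have pYi : pos Yi by exact: pos_scale_sum.
have pYj : pos Yj by exact: pos_scale_sum.
have pZj : pos Zj by exact: pos_scale_head.
have be4 : 0 <= 1 - 4 * be by lra.
have pZ : pos (Z - Zi) by apply: scale_head_mono; exact: ltnW.
have jN : 0 <= N%:R - j%:R :> R by rewrite subr_ge0 ler_nat ltnW// (ltn_trans ji).
have q1 : pos (scal (2 * al)) by apply: pos_scal; lra.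
have q2 : pos (scal (4 * al)) by apply: pos_scal; lra.
have q3 : pos (scal (8 * (c^-1 - al))) by apply: pos_scal; lra.
have q4 : pos (scal 2) by exact: pos_scal.
have q5 : pos (scal (4 * be)) by apply: pos_scal; lra.
have q6 : pos (scal (1 - 4 * be)) by exact: pos_scal.
have q7 : pos (scal (4 * (N%:R - j%:R) * c^-1 ^+ L.+1)).
  by apply: pos_scal; rewrite !mulr_ge0.
have q8 : pos (scal (4 * j%:R * c^-1 ^+ L.+1)).
  by apply: pos_scal; rewrite !mulr_ge0.
by do ![assumption | apply: posD | apply: posM].
Qed.

Lemma scale_resolvent u v e : 0 < e ->
  exists T, (scale_sum u + scale_sum v + scal e) * T = 1.
Proof.
move=> e0; have [b b0 bu] := scale_sum_bound u.
have [b' b'0 bv] := scale_sum_bound v.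
apply: (shifted_inverse (b := b + b')) => //; first exact: addr_ge0.
  by apply: posD; exact: pos_scale_sum.
have -> : scal (b + b') - (scale_sum u + scale_sum v) =
  (scal b - scale_sum u) + (scal b' - scale_sum v) by ring.
exact: posD.
Qed.

End ScaleSums.

(** * Averaging over the shears *)

Section ShearEstimate.
Context {R : realType} {V : lmodType R} {ip : hilbert_form V} {F : fieldType}
  {W : lmodType F} (U : unitary_family ip W).
Variables (lam : F) (c : R) (L : nat).
Implicit Types (x y : V) (u v : W).

Local Notation sqn := (sqn ip).
Local Notation lap := (lap U).
Local Notation scal := (scal U).
Local Notation scale_sum := (scale_sum U lam c L).
Local Notation scale_head := (scale_head U lam c).

Hypothesis c4 : 4 <= c.

Let c0 : 0 < c. Proof. by apply: lt_le_trans c4; rewrite ltr0n. Qed.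

(** The term of scale [k] is at most the whole sum, and the sum times its resolvent is at most 1;
    the factor [c ^+ k] undoes the weight. *)
Lemma state_lap_resolvent k u Y (T : sa_op U) e y : 0 < e -> (k <= L)%N ->
  pos Y -> (scale_sum u + Y + scal e) * T = 1 ->
  state y (lap (lam ^+ k *: u) * T) <= c ^+ k * sqn y.
Proof.
move=> e0 kL Yp YT; have Xp : pos (scale_sum u) by exact: pos_scale_sum.
have Tp : pos T.
  by apply: (pos_inv YT); do 2?apply: posD => //; apply: pos_scal; exact: ltW.
have := state_le y (resolvent_le1 e0 Xp Yp YT).
have := state_le y (S := scal (c^-1 ^+ k) * lap (lam ^+ k *: u) * T)
  (T := scale_sum u * T).
rewrite -mulrBl => /(_ (posM (scale_sum_term lam c4 u kL) Tp)).
rewrite -mulrA stateZ state1 => h1 h2.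
rewrite -(ler_pM2l (_ : 0 < c^-1 ^+ k)) ?exprn_gt0 ?invr_gt0//.
by rewrite mulrA -exprMn mulVf ?gt_eqF// expr1n mul1r (le_trans h1).
Qed.

(** Each of the [N] terms is estimated by [lap_mulrn_bound] with constant [c ^+ l], which the weight
    [c^-1 ^+ l] cancels. *)
Lemma scale_head_bound N u Y (T : sa_op U) e x s k : 0 < e -> (N <= L)%N ->
  pos Y -> (scale_sum u + Y + scal e) * T = 1 -> 0 <= s ->
  (forall l, (l < N)%N -> exists M, [/\ (0 < M)%N,
    forall m, (m < M)%N -> sqn (x - U ((lam ^+ l *: u) *+ m) x) <= k &
    2 / M%:R ^+ 2 * state x (lap ((lam ^+ l *: u) *+ M) * T) <= s]) ->
  state x (scale_head N u * T) <= N%:R * (s + 2 * k).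
Proof.
move=> e0 NL Yp YT s0 small.
have Tp : pos T.
  apply: (pos_inv YT); do 2?apply: posD => //; first exact: pos_scale_sum.
  by apply: pos_scal; exact: ltW.
rewrite mulr_suml state_sum big_mkord.
have -> : N%:R * (s + 2 * k) = \sum_(l < N) (s + 2 * k).
  by rewrite sumr_const card_ord -[RHS]mulr_natl.
apply: ler_sum => l _; rewrite /scale_term -mulrA stateZ.
have [M [M0 xk Ms]] := small l (ltn_ord l).
have cl : c^-1 ^+ l * c ^+ l = 1 by rewrite -exprMn mulVf ?gt_eqF// expr1n.
have cl0 : 0 < c^-1 ^+ l by rewrite exprn_gt0// invr_gt0.
have cl1 : c^-1 ^+ l <= 1.
  rewrite exprn_ile1 ?invr_ge0 ?(ltW c0)// invf_le1//.
  by apply: le_trans c4; rewrite ler1n.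
have Tl y := state_lap_resolvent y e0 (ltnW (leq_trans (ltn_ord l) NL)) Yp YT.
have bound := lap_mulrn_bound M0 Tp (exprn_ge0 l (ltW c0)) xk Tl.
apply: le_trans (ler_wpM2l (ltW cl0) bound) _; rewrite mulrDr lerD//.
  apply: le_trans (ler_piMl _ cl1) Ms; rewrite mulr_ge0 ?divr_ge0 ?exprn_ge0//.
  by apply: state_ge0; apply: posM => //; exact: pos_lap.
have -> : c^-1 ^+ l * (2 * c ^+ l * k) = c^-1 ^+ l * c ^+ l * (2 * k) by ring.
by rewrite cl mul1r.
Qed.

(** [J i] carries X Q to X T_i, and moves [x] by at most [d], so state x (X Q) <= 2 state x (X T_i)
    + 2 d for each of the [N] shears. The operators X T_i are almost orthogonal by
    [shear_separation] and [resolvent_cross], so their states add up to at most 2. *)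
Lemma shear_estimate N (J : nat -> {linear V -> V}) (g : nat -> {linear W -> W})
    u1 u2 x Q e d z f :
  sqn x = 1 -> 0 < e -> 0 <= f ->
  (forall i x y, ip (J i x) (J i y) = ip x y) ->
  (forall i w x, J i (U w x) = U (g i w) (J i x)) ->
  (forall i, g i u1 = u1) -> (forall i, g i u2 = u2 + lam ^+ i *: u1) ->
  (forall i, (i < N)%N -> sqn (J i x - x) <= d) ->
  (scale_sum u1 + scale_sum u2 + scal e) * Q = 1 ->
  (forall i T, (i < N)%N ->
    (scale_sum u1 + scale_sum (u2 + lam ^+ i *: u1) + scal e) * T = 1 ->
    state x (scale_head N u1 * T) <= z) ->
  f * e = 4 * N%:R * c^-1 ^+ L.+1 ->
  0 <= z -> N%:R ^+ 2 * (8 / c + 2 * z + f) <= 2 ->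
  N%:R * state x (scale_sum u1 * Q) <= 4 + 2 * N%:R * d.
Proof.
move=> x1 e0 f0 Jip JU g1 g2 Jx BQ headz fe z0 Nsmall.
pose X := scale_sum u1; pose Y i := scale_sum (u2 + lam ^+ i *: u1).
have Xp : pos X by exact: pos_scale_sum.
have Yp i : pos (Y i) by exact: pos_scale_sum.
have /choice[T TP] : forall i, exists T, (X + Y i + scal e) * T = 1.
  by move=> i; exact: scale_resolvent.
have Tp i : pos (T i).
  apply: (pos_inv (TP i)); apply: posD; first exact: posD.
  by apply: pos_scal; exact: ltW.
have Jsum i u y : J i (scale_sum u y) = scale_sum (g i u) (J i y).
  have sumE (h : nat -> sa_op U) t : (\sum_(0 <= k < L.+1) h k) t =
      \sum_(0 <= k < L.+1) h k t.
    by elim/big_rec2: _ => // k a S _ <-.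
  rewrite !sumE linear_sum; apply: eq_bigr => k _ /=.
  rewrite linearZ /=; congr (_ *: _).
  by rewrite !linearB linearZ /= !JU [g i (- _)]linearN [g i (_ *: _)]linearZ.
have stT i : state (J i x) (X * T i) = state x (X * Q).
  apply: (state_resolvent_intertwine _ (Jip i) _ _ BQ (TP i)) => y.
    by rewrite Jsum g1.
  by rewrite Jsum g2.
have stQ i : (i < N)%N -> state x (X * Q) <= 2 * state x (X * T i) + 2 * d.
  move=> iN; rewrite -(stT i).
  have -> : J i x = x + (J i x - x) by rewrite addrC subrK.
  apply: le_trans (stateD_le _ _ (posM Xp (Tp i))) _.
  rewrite lerD2l ler_pM2l//; apply: le_trans (Jx i iN).
  rewrite -(state1 U); apply: state_le.
  exact: resolvent_le1 (TP i).
have sum2 : \sum_(i < N) state x (X * T i) <= 2.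
  apply: (sum_state_le2 (k := 8 / c + 2 * z + f)) => // [|i|i j ij].
  - by rewrite !addr_ge0// ?mulr_ge0// ?invr_ge0 ltW.
  - by apply: state_le; exact: resolvent_sqr (TP i).
  have sep : pos (scal (8 / c) * (Y i + Y j) + scal 2 * scale_head N u1 +
      scal f * scal e - X).
    rewrite -(rmorphM scal) fe.
    move: ij; rewrite neq_ltn => /orP[ij|ij].
      by rewrite [Y i + _]addrC; apply: shear_separation.
    by apply: shear_separation.
  have Zp : pos (scal 2 * scale_head N u1).
    by apply: posM; [exact: pos_scal|exact: pos_scale_head].
  have c80 : 0 <= 8 / c by rewrite divr_ge0 ?ltW.
  have := resolvent_cross e0 c80 f0 Xp (Yp i) (Yp j) Zp (TP i) (TP j) sep.
  move=> /(state_le x)/le_trans; apply.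
  rewrite !stateD !state_scal x1 -mulrA stateZ !mulr1.
  rewrite lerD2r lerD2l ler_pM2l//; exact: headz (ltn_ord j) (TP j).
have -> : N%:R * state x (X * Q) = \sum_(i < N) state x (X * Q).
  by rewrite sumr_const card_ord -[RHS]mulr_natl.
apply: le_trans (_ : \sum_(i < N) (2 * state x (X * T i) + 2 * d) <= _).
  by apply: ler_sum => i _; exact: stQ.
rewrite big_split /= -mulr_sumr sumr_const card_ord -[(2 * d) *+ N]mulr_natl.
by move: sum2; set S := \sum_(i < N) _ => sum2; lra.
Qed.

End ShearEstimate.

(** * Relative property (T) *)

Section AbsoluteValue.
Context {R : realType} {F : fieldType} (v : absolute_value R F).

Lemma absvalX x n : v (x ^+ n) = v x ^+ n.
Proof.
by elim: n => [|n IH]; rewrite ?expr0 ?absval1// !exprS absvalM IH.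
Qed.

Lemma absval_nat n : v n%:R <= n%:R.
Proof.
elim: n => [|n IH]; first by rewrite absval0.
rewrite -addn1 !natrD; apply: le_trans (absvalD v _ _) _.
by rewrite lerD//; rewrite absval1.
Qed.

(* A common expanding factor: in the archimedean case it is a large integer. *)
Lemma expanding_scale C : (exists t, 1 < v t) ->
  exists2 lam, 1 < v lam & (forall m : nat, v m%:R <= 1) \/
                           (exists2 l, (C <= l)%N & lam = l%:R).
Proof.
case=> t t1; have [na|/existsNP[m /negP]] := pselect (forall m : nat, v m%:R <= 1).
  by exists t => //; left.
rewrite -ltNge => m1; exists (m%:R ^+ C.+1).
  by rewrite absvalX exprn_egt1.
right; exists (m ^ C.+1)%N; last by rewrite natrX.
have m2 : (1 < m)%N.
  by rewrite -(ltr_nat R) (lt_le_trans m1) ?absval_nat.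
exact: ltnW (leq_trans (ltn_expl _ m2) (leq_pexp2l (ltnW m2) (leqnSn C))).
Qed.

End AbsoluteValue.

Section RelativeT.
Context {R : realType} {F : fieldType} (v : absolute_value R F).
Variables (N : nat) (lam : F).

(** With this value N^2 (8 / c) = 1, which keeps the cross terms of [N] shears bounded. By [lamP],
    an integral [lam] given by the second alternative is at least [c]. *)
Let c : R := (8 * N ^ 2)%N%:R.

Hypotheses (N0 : (0 < N)%N) (lam1 : 1 < v lam)
  (lamP : (forall m : nat, v m%:R <= 1) \/
          (exists2 l, (8 * N ^ 2 <= l)%N & lam = l%:R)).

Let c4 : 4 <= c.
Proof. by rewrite ler_nat; case: N N0 => // n _; rewrite (@leq_mul 4 1)// expn_gt0. Qed.
Let c0 : 0 < c. Proof. by apply: lt_le_trans c4; rewrite ltr0n. Qed.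
Let NR : 0 < N%:R :> R. Proof. by rewrite ltr0n. Qed.

(** The quantifiers matter: [n0] and [B] are fixed before [e] and [L]. If all integers have absolute
    value at most 1, multiples of a vector are no larger than it, so the [M] of [scale_head_bound]
    may grow with 1 / e. Otherwise M = l^n0 and the M-th multiple is the dilation by [lam ^+ n0]:
    the resolvent bound costs c^n0 against a gain of l^(2 n0), and c <= l. *)
Lemma scale_head_small s : 0 < s -> exists n0 (B : R), 0 < B /\
  forall (V : lmodType R) (ip : hilbert_form V) (W : lmodType F)
    (U : unitary_family ip W) (w : W) (a0 : F) (x : V) r L e Y T,
    sqn ip x = 1 -> v a0 * B < r ->
    (forall b, v b < r -> sqn ip (x - U (b *: w) x) <= s) ->
    (N + n0 <= L)%N -> 0 < e -> pos Y ->
    (scale_sum U lam c L (a0 *: w) + Y + scal U e) * T = 1 ->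
    state x (scale_head U lam c N (a0 *: w) * T) <= N%:R * (s + 2 * s).
Proof.
move=> s0; have lamN : 1 <= v lam ^+ N by apply: exprn_ege1; exact: ltW.
have lamlN l : (l < N)%N -> v lam ^+ l <= v lam ^+ N.
  by move=> lN; apply: ler_weXn2l; [exact: ltW|exact: ltnW].
have lam0 : 0 < v lam by exact: lt_trans ltr01 lam1.
case: lamP => [na|[l cl lamE]].
  exists 0%N, (v lam ^+ N); split => [|V ip W U w a0 x r L e Y T x1 ar xs NL e0 Yp YT].
    exact: lt_le_trans lamN.
  rewrite addn0 in NL.
  apply: (scale_head_bound c4 e0 NL Yp YT (ltW s0)) => l lN.
  (* The crude bound 4 / e on the state of [D * T] leaves 2 / M^2 * 4 / e, which is at most [s] once
     M exceeds 8 / (e s). *)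
  pose M := (Num.truncn (8 / e / s)).+1.
  have MP : 8 / e / s < M%:R by exact: truncnS_gt.
  exists M; split => // [m mM|].
    rewrite -scaler_nat !scalerA; apply: xs; apply: le_lt_trans ar.
    rewrite !absvalM absvalX mulrC ler_wpM2l ?absval_ge0//.
    by apply: le_trans (lamlN l lN); rewrite ler_piMl ?exprn_ge0 ?absval_ge0.
  have Xp : pos (scale_sum U lam c L (a0 *: w)) by exact: pos_scale_sum.
  have Tp : pos T.
    apply: (pos_inv YT); apply: posD; first exact: posD.
    by apply: pos_scal; exact: ltW.
  set D := lap U _.
  have DT : state x (D * T) <= 4 / e.
    have := state_le x (S := D * T) (T := scal U (4 / e)).
    rewrite state_scal x1 mulr1; apply.
    have -> : scal U (4 / e) - D * T =
      scal U 4 * (scal U e^-1 - T) + (scal U 4 - D) * T by ring.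
    apply: posD; last by apply: posM => //; exact: pos_lap_le4.
    by apply: posM; [exact: pos_scal|exact: resolvent_norm YT].
  have M1 : 1 <= M%:R :> R by rewrite ler1n.
  have M0 : 0 < M%:R :> R by exact: lt_le_trans M1.
  have M2 : 0 <= 2 / M%:R ^+ 2 :> R by rewrite divr_ge0 ?exprn_ge0 ?ltW.
  apply: le_trans (ler_wpM2l M2 DT) _.
  rewrite mulrAC ler_pdivrMr ?exprn_gt0//.
  have -> : 2 * (4 / e) = 8 / e by ring.
  rewrite [leRHS]mulrC -ler_pdivrMr// expr2.
  by apply: le_trans (ltW MP) _; rewrite ler_peMl// ltW.
have l1 : (1 < l)%N.
  by apply: leq_trans cl; case: N N0 => // n _; rewrite (@leq_mul 2 1)// expn_gt0.
have l0R : 0 < l%:R :> R by rewrite ltr0n ltnW.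
have [||n0 n0P] := @geometric_lt R l%:R^-1 (s / (2 * c ^+ N)).
- by rewrite invr_ge0 ltW//= invf_lt1// ltr1n.
- by rewrite divr_gt0// mulr_gt0// exprn_gt0.
exists n0, (l%:R ^+ n0 * v lam ^+ N); split => [|V ip W U w a0 x r L e Y T x1 ar xs NL e0 Yp YT].
  by rewrite mulr_gt0 ?exprn_gt0.
apply: (scale_head_bound c4 e0 (leq_trans (leq_addr _ _) NL) Yp YT (ltW s0)) => k kN.
(* Multiplying by the integer [l ^ n0] moves scale [k] to scale [k + n0], still at most [L], where
   [state_lap_resolvent] applies. *)
exists (l ^ n0)%N; split => [|m mM|]; first by rewrite expn_gt0 ltnW.
  rewrite -scaler_nat !scalerA; apply: xs; apply: le_lt_trans ar.
  rewrite !absvalM absvalX mulrC ler_wpM2l ?absval_ge0//.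
  apply: ler_pM; rewrite ?absval_ge0 ?exprn_ge0 ?absval_ge0 ?lamlN//.
  by apply: le_trans (absval_nat _ _) _; rewrite -natrX ler_nat ltnW.
set w' := lam ^+ k *: (a0 *: w).
have -> : w' *+ (l ^ n0) = lam ^+ (k + n0) *: (a0 *: w).
  by rewrite /w' -scaler_nat scalerA natrX -lamE -exprD addnC.
have kL : (k + n0 <= L)%N by apply: leq_trans NL; rewrite leq_add2r ltnW.
have := state_lap_resolvent c4 x e0 kL Yp YT; rewrite x1 mulr1 => DT.
have l2 : 0 <= 2 / (l ^ n0)%N%:R ^+ 2 :> R by rewrite divr_ge0 ?exprn_ge0.
apply: le_trans (ler_wpM2l l2 DT) _.
have cl' : c <= l%:R by rewrite ler_nat.
have c1 : 1 <= c by apply: le_trans c4; rewrite ler1n.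
apply: le_trans (_ : 2 * c ^+ N * l%:R^-1 ^+ n0 <= _); last first.
  rewrite mulrC -ler_pdivlMr ?mulr_gt0 ?exprn_gt0//.
  by apply: ltW; exact: n0P.
have -> : 2 / (l ^ n0)%N%:R ^+ 2 * c ^+ (k + n0) =
    2 * c ^+ k * l%:R^-1 ^+ n0 * (c / l%:R) ^+ n0 :> R.
  rewrite natrX exprD exprMn !exprVn; field.
  by rewrite expf_neq0// gt_eqF.
have cln : (c / l%:R) ^+ n0 <= 1.
  by apply: exprn_ile1; [rewrite divr_ge0// ltW|rewrite ler_pdivrMr// mul1r].
apply: le_trans (ler_piMr _ cln) _.
  by rewrite !mulr_ge0 ?exprn_ge0 ?invr_ge0 ?(ltW c0)// ltW.
rewrite ler_wpM2r ?exprn_ge0 ?invr_ge0 ?(ltW l0R)//.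
by rewrite ler_pM2l//; apply: ler_weXn2l => //; exact: ltnW.
Qed.

(** [shear_estimate] is applied once with each coordinate fixed. Each application gives 4 / N + 2 d;
    their sum is multiplied by 4, the bound for a Laplacian. *)
Lemma line_almost_fixed (V : lmodType R) (ip : hilbert_form V) (W : lmodType F)
    (U : unitary_family ip W) (e1 e2 : W) (J J' : nat -> {linear V -> V})
    (g g' : nat -> {linear W -> W}) x d :
  sqn ip x = 1 ->
  (forall i x y, ip (J i x) (J i y) = ip x y) ->
  (forall i x y, ip (J' i x) (J' i y) = ip x y) ->
  (forall i w x, J i (U w x) = U (g i w) (J i x)) ->
  (forall i w x, J' i (U w x) = U (g' i w) (J' i x)) ->
  (forall i, g i e1 = e1) -> (forall i, g i e2 = e2 + lam ^+ i *: e1) ->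
  (forall i, g' i e2 = e2) -> (forall i, g' i e1 = e1 + lam ^+ i *: e2) ->
  (forall i, (i < N)%N -> sqn ip (J i x - x) <= d) ->
  (forall i, (i < N)%N -> sqn ip (J' i x - x) <= d) ->
  (forall k, 0 < k -> exists2 r, 0 < r & forall b, v b < r ->
     sqn ip (x - U (b *: e1) x) <= k /\ sqn ip (x - U (b *: e2) x) <= k) ->
  forall a, sqn ip (x - U (a *: e1) x) <= 32 / N%:R + 16 * d.
Proof.
move=> x1 Jip J'ip JU J'U g1 g2 g'2 g'1 Jx J'x xcont a.
(* Order of choices: [a0 = lam^-k a] small by continuity at [x], then [e] small
   against [c^-k], then [L] large against [1 / e]. *)
apply/ler_addgt0Pr => h h0.
(* Then z = 3 N s contributes N^2 (2 z) = 1/2 to the bound 2 in [Nsmall]; [8 / c] contributes 1, and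
   [f] the remaining 1/2. *)
pose s := (12 * N%:R ^+ 3)^-1 : R.
have s0 : 0 < s by rewrite invr_gt0 mulr_gt0 ?exprn_gt0.
have [n0 [B [B0 head]]] := scale_head_small s0.
have [r r0 xr] := xcont s s0.
have lam0 : 0 < v lam by exact: lt_trans ltr01 lam1.
have lamN0 : lam != 0.
  by apply: contraTneq lam0 => ->; rewrite absval0 ltxx.
have [||k kP] := @geometric_lt R (v lam)^-1 (r / ((v a + 1) * B)).
- by rewrite invr_ge0 ltW//= invf_lt1.
- by rewrite divr_gt0// mulr_gt0// ltr_wpDl ?absval_ge0.
pose a0 := lam^-1 ^+ k * a.
have a0E : lam ^+ k * a0 = a.
  by rewrite /a0 mulrA -exprMn divff// expr1n mul1r.
have va0 : v a0 = (v lam)^-1 ^+ k * v a.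
  by rewrite -a0E absvalM absvalX mulrA -exprMn mulVf ?gt_eqF// expr1n mul1r.
have a0r : v a0 * B < r.
  have := kP k (leqnn k); rewrite ltr_pdivlMr; last first.
    by rewrite mulr_gt0// ltr_wpDl ?absval_ge0.
  apply: le_lt_trans; rewrite mulrA ler_pM2r// va0 ler_pM2l ?exprn_gt0 ?invr_gt0//.
  by rewrite lerDl.
pose e := h / c ^+ k.
have ck0 : 0 < c ^+ k by rewrite exprn_gt0.
have e0 : 0 < e by rewrite divr_gt0.
(* This threshold is what makes N^2 f <= 1/2, where [f] is the truncation error at scale [L]
   relative to [e]. *)
have [||n1 n1P] := @geometric_lt R c^-1 (e / (8 * N%:R ^+ 3)).
- by rewrite invr_ge0 (ltW c0)//= invf_lt1// (lt_le_trans _ c4)// ltr1n.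
- by rewrite divr_gt0// mulr_gt0// exprn_gt0.
pose L := (k + (N + n0) + n1)%N.
have kL : (k <= L)%N by rewrite /L -addnA leq_addr.
have NL : (N + n0 <= L)%N by rewrite /L addnAC leq_addl.
pose f := 4 * N%:R * c^-1 ^+ L.+1 / e.
have f0 : 0 <= f.
  by rewrite divr_ge0 ?(ltW e0)// !mulr_ge0// exprn_ge0// invr_ge0 ltW.
have fe : f * e = 4 * N%:R * c^-1 ^+ L.+1 by rewrite divfK// gt_eqF.
have fN : N%:R ^+ 2 * f <= 2^-1.
  have : c^-1 ^+ L.+1 < e / (8 * N%:R ^+ 3).
    by apply: n1P; apply: leqW; exact: leq_addl.
  rewrite /f ltr_pdivlMr ?mulr_gt0 ?exprn_gt0//; set q := c^-1 ^+ _ => qe.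
  have -> : N%:R ^+ 2 * (4 * N%:R * q / e) = q * (8 * N%:R ^+ 3) / e * 2^-1.
    by field; rewrite gt_eqF.
  by apply: ler_piMl; rewrite ?invr_ge0// ler_pdivrMr// mul1r ltW.
pose z := N%:R * (s + 2 * s).
have zE : N%:R ^+ 2 * (2 * z) = 2^-1.
  by rewrite /z /s; field; rewrite gt_eqF.
have z0 : 0 <= z by rewrite mulr_ge0// addr_ge0// ?mulr_ge0// ltW.
have cE : N%:R ^+ 2 * (8 / c) = 1.
  by rewrite /c natrM natrX; field; rewrite gt_eqF.
have Nsmall : N%:R ^+ 2 * (8 / c + 2 * z + f) <= 2.
  by rewrite !mulrDr zE cE; lra.
have [Q QP] := scale_resolvent U lam L c4 (a0 *: e1) (a0 *: e2) e0.
pose X := scale_sum U lam c L (a0 *: e1).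
pose Y := scale_sum U lam c L (a0 *: e2).
have Xp : pos X by exact: pos_scale_sum.
have Yp : pos Y by exact: pos_scale_sum.
have Xsmall : N%:R * state x (X * Q) <= 4 + 2 * N%:R * d.
  apply: (shear_estimate c4 x1 e0 f0 Jip JU _ _ Jx QP _ fe z0 Nsmall) => [i|i|i T iN TP].
  - by rewrite linearZ g1.
  - by rewrite linearZ g2 /= scalerDr !scalerA mulrC.
  apply: (head V ip W U e1 a0 x r L e _ T x1 a0r _ NL e0 _ TP) => [b /xr[]//|].
  exact: pos_scale_sum.
have Ysmall : N%:R * state x (Y * Q) <= 4 + 2 * N%:R * d.
  have QP' : (Y + X + scal U e) * Q = 1 by rewrite -QP [Y + X]addrC.
  apply: (shear_estimate c4 x1 e0 f0 J'ip J'U _ _ J'x QP' _ fe z0 Nsmall) => [i|i|i T iN TP].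
  - by rewrite linearZ g'2.
  - by rewrite linearZ g'1 /= scalerDr !scalerA mulrC.
  apply: (head V ip W U e2 a0 x r L e _ T x1 a0r _ NL e0 _ TP) => [b /xr[]//|].
  exact: pos_scale_sum.
have := state_lap_resolvent c4 x e0 kL Yp QP; rewrite x1 mulr1 scalerA a0E.
rewrite -state_lap; set D := lap U _ => DQ.
have Qp : pos Q.
  by apply: (pos_inv QP); do 2?apply: posD => //; apply: pos_scal; exact: ltW.
(* Write D = D (X + Y + e) Q and use D <= 4 on the part without [e]. The part with [e] is at most e
   c^k = h, because [a] is the [k]-th scale of [a0]. *)
have : state x D <= 4 * (state x (X * Q) + state x (Y * Q)) + e * state x (D * Q).
  rewrite -stateD -!stateZ -stateD; apply: state_le.
  have -> : scal U 4 * (X * Q + Y * Q) + scal U e * (D * Q) - D =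
      (scal U 4 - D) * ((X + Y) * Q).
    have {2}-> : D = D * ((X + Y + scal U e) * Q) by rewrite QP mulr1.
    ring.
  apply: posM; first exact: pos_lap_le4.
  by apply: posM => //; exact: posD.
have eD : e * state x (D * Q) <= h.
  apply: le_trans (ler_wpM2l (ltW e0) DQ) _.
  by rewrite /e mulfVK// gt_eqF.
have XN : state x (X * Q) <= 4 / N%:R + 2 * d.
  rewrite -(ler_pM2l NR); apply: le_trans Xsmall _.
  by rewrite mulrDr mulrCA divff ?gt_eqF// mulr1 mulrA [N%:R * 2]mulrC.
have YN : state x (Y * Q) <= 4 / N%:R + 2 * d.
  rewrite -(ler_pM2l NR); apply: le_trans Ysmall _.
  by rewrite mulrDr mulrCA divff ?gt_eqF// mulr1 mulrA [N%:R * 2]mulrC.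
have -> : 32 / N%:R = 8 * (4 / N%:R) :> R by rewrite [RHS]mulrA -natrM.
lra.
Qed.

End RelativeT.

(** * Bounded generation by transvections *)

Section Transvections.
Context {F : fieldType}.

Definition trv n (i j : 'I_n) (b : F) : 'M[F]_n := 1%:M + b *: delta_mx i j.

Lemma trv0 n (i j : 'I_n) : trv i j 0 = 1%:M.
Proof. by rewrite /trv scale0r addr0. Qed.

Lemma trvD n (i j : 'I_n) b c : i != j ->
  trv i j b *m trv i j c = trv i j (b + c).
Proof.
move=> ij; rewrite /trv mulmxDl mul1mx mulmxDr mulmx1 -scalemxAl -scalemxAr.
by rewrite mul_delta_mx_0 1?eq_sym// !scaler0 addr0 scalerDl addrA addrAC.
Qed.

Lemma trv_comm n (i j k l : 'I_n) b c : j != k -> l != i ->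
  trv i j b *m trv k l c = trv k l c *m trv i j b.
Proof.
move=> jk li; rewrite /trv !mulmxDl !mul1mx !mulmxDr !mulmx1.
rewrite -!scalemxAl -!scalemxAr !mul_delta_mx_0// !scaler0 !addr0.
by rewrite addrAC.
Qed.

(** The commutator relation of elementary matrices, written without inverses. *)
Lemma trv_braid n (i k s : 'I_n) t b : i != k -> k != s -> i != s ->
  trv i k t *m trv k s b = trv i s (t * b) *m trv k s b *m trv i k t.
Proof.
move=> ik ks iks; rewrite /trv !mulmxDl !mul1mx !mulmxDr !mulmx1.
rewrite !mulmxDl ?mul1mx -!scalemxAl -!scalemxAr mul_delta_mx.
rewrite !mul_delta_mx_0 1?eq_sym// !(scaler0, addr0, mul0mx, scaler0) scalerA.
rewrite -!addrA; congr (_ + _); rewrite !addrA.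
Qed.

Lemma trvE n (i j : 'I_n) b p (A : 'M[F]_(n, p)) k l :
  (trv i j b *m A) k l = A k l + b * A j l *+ (k == i).
Proof.
rewrite /trv mulmxDl mul1mx mxE -scalemxAl !mxE (bigD1 j) //= big1 => [|j' j'j].
  by rewrite mxE eqxx andbT addr0 mulr_natl mulrnAr.
by rewrite mxE (negPf j'j) andbF mul0r.
Qed.

Lemma det_trv n (i j : 'I_n) b : i != j -> \det (trv i j b) = 1.
Proof.
move=> ij; wlog ji : i j ij / (j < i)%N => [wl|].
  have [/wl->//|] := ltnP j i; rewrite leq_eqVlt => /orP[/eqP/val_inj/eqP|ij'].
    by rewrite (negPf ij).
  rewrite -det_tr -(wl j i) 1?eq_sym//; congr (\det _).
  by rewrite /trv linearD /= trmx1 linearZ /= trmx_delta.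
rewrite det_trig.
  by rewrite big1// => k _; rewrite !mxE eqxx; case: eqVneq => [->|_] /=;
     rewrite ?(negPf ij) mulr0 addr0.
apply/is_trig_mxP => k l kl; rewrite !mxE (_ : (k == l) = false); last first.
  by apply/eqP => kl'; rewrite kl' ltnn in kl.
case: eqVneq => [ki|_] /=; last by rewrite mulr0 addr0.
case: eqVneq => [lj|_] /=; last by rewrite mulr0 addr0.
by move: kl; rewrite ki lj ltnNge ltnW.
Qed.

(** [TrvgenW] makes the index an upper bound for the length of a word, not the exact length. *)
Inductive trvgen n : nat -> 'M[F]_n -> Prop :=
| Trvgen1 : trvgen 0 1%:M
| TrvgenW l A : trvgen l A -> trvgen l.+1 A
| TrvgenM l i j b A : i != j -> trvgen l A -> trvgen l.+1 (trv i j b *m A).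

Lemma trvgenM n k l (A B : 'M[F]_n) :
  trvgen k A -> trvgen l B -> trvgen (k + l) (A *m B).
Proof.
move=> Ak Bl; elim: Ak => {k A} [|k A _ IH|k i j b A ij _ IH].
- by rewrite mul1mx.
- by rewrite addSn; exact: TrvgenW.
- by rewrite addSn -mulmxA; exact: TrvgenM.
Qed.

Lemma trvgen_divl n l i j b (A : 'M[F]_n) : i != j ->
  trvgen l (trv i j b *m A) -> trvgen l.+1 A.
Proof.
move=> ij /(TrvgenM (- b) ij); rewrite mulmxA trvD// addNr trv0.
by rewrite mul1mx.
Qed.

(** One transvection per row, all in column [j]; no cross terms arise since [w j 0 = 0]. *)
Lemma trvgen_col n (j : 'I_n) (w : 'cV[F]_n) : w j 0 = 0 ->
  trvgen n (1%:M + w *m delta_mx 0 j).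
Proof.
move=> wj; have -> : w = \sum_(i <- index_enum 'I_n) w i 0 *: delta_mx i 0.
  rewrite {1}[w]matrix_sum_delta; apply: eq_bigr => i _.
  by rewrite big_ord1.
have {2}<- : size (index_enum 'I_n) = n by rewrite -[RHS]card_ord cardT enumT.
elim: (index_enum 'I_n) => [|i s IH].
  by rewrite big_nil mul0mx addr0; exact: Trvgen1.
rewrite big_cons /=; have [->|ij] := eqVneq i j.
  by rewrite wj scale0r add0r; exact: TrvgenW.
set S := \sum_(_ <- s) _ in IH *.
have SS : delta_mx i j *m S = 0.
  rewrite mulmx_sumr big1// => k _; rewrite -scalemxAr.
  have [->|kj] := eqVneq k j; first by rewrite wj scale0r.
  by rewrite mul_delta_mx_0 1?eq_sym// scaler0.
have := TrvgenM (w i 0) ij IH; congr trvgen.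
rewrite /trv mulmxDl mul1mx -scalemxAl mulmxDr mulmx1 mulmxA SS mul0mx addr0.
by rewrite mulmxDl -scalemxAl mul_delta_mx addrAC -addrA.
Qed.

Lemma trvgen_tr n l (A : 'M[F]_n) : trvgen l A -> trvgen l A^T.
Proof.
elim=> {l A} [|l A _ IH|l i j b A ij _ IH].
- by rewrite trmx1; exact: Trvgen1.
- exact: TrvgenW.
rewrite trmx_mul -addn1; apply: trvgenM => //.
have -> : (trv i j b)^T = trv j i b *m 1%:M.
  by rewrite mulmx1 /trv linearD /= trmx1 linearZ /= trmx_delta.
by apply: TrvgenM; rewrite 1?eq_sym//; exact: Trvgen1.
Qed.

Lemma trvgen_lblock n (c : 'cV[F]_n) :
  trvgen n.+1 (block_mx 1%:M 0 c 1%:M : 'M[F]_(1 + n)).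
Proof.
have := @trvgen_col (1 + n) (lshift n 0) (col_mx 0 c).
rewrite col_mxEu mxE => /(_ erefl); congr trvgen.
have -> : delta_mx 0 (lshift n 0) = row_mx 1%:M 0 :> 'rV[F]_(1 + n).
  apply/matrixP => i j; rewrite !mxE ord1 /=; case: fintype.splitP => k kE.
    by rewrite mxE ord1 /= -val_eqE /= kE ord1.
  by rewrite mxE -val_eqE /= kE.
rewrite mul_col_row !(mul0mx, mulmx1, mulmx0) scalar_mx_block add_block_mx.
by rewrite !addr0 !add0r.
Qed.

Lemma trvgen_ublock n (r : 'rV[F]_n) :
  trvgen n.+1 (block_mx 1%:M r 0 1%:M : 'M[F]_(1 + n)).
Proof.
have := trvgen_tr (trvgen_lblock r^T).
by rewrite (tr_block_mx 1%:M 0 r^T) !trmx1 trmx0 trmxK.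
Qed.

Lemma trvgen_lift n l (A : 'M[F]_n) :
  trvgen l A -> trvgen l (block_mx 1%:M 0 0 A : 'M[F]_(1 + n)).
Proof.
elim=> {l A} [|l A _ IH|l i j b A ij _ IH].
- by rewrite -scalar_mx_block; exact: Trvgen1.
- exact: TrvgenW.
have := TrvgenM (i := rshift 1 i) (j := rshift 1 j) b _ IH.
rewrite (inj_eq (@rshift_inj _ _)) => /(_ ij); congr trvgen.
have -> : trv (rshift 1 i) (rshift 1 j) b =
    block_mx 1%:M 0 0 (trv i j b) :> 'M[F]_(1 + n).
  rewrite /trv scalar_mx_block.
  have -> : delta_mx (rshift 1 i) (rshift 1 j) =
      block_mx 0 0 0 (delta_mx i j) :> 'M[F]_(1 + n).
    apply/matrixP => p q; rewrite -[p]fintype.splitK -[q]fintype.splitK.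
    case: (fintype.split p) => p'; case: (fintype.split q) => q' /=;
    rewrite ?block_mxEul ?block_mxEur ?block_mxEdl ?block_mxEdr !mxE
      ?eq_lrshift ?andbF ?(inj_eq (@rshift_inj _ _)) //.
  by rewrite scale_block_mx !scaler0 add_block_mx !addr0.
by rewrite mulmx_block !mul1mx !mul0mx !mulmx0 !addr0 add0r.
Qed.

(** Gaussian elimination: at most two row operations make the corner entry 1, and the matrix then
    factors into two unipotent block matrices and a block of size one less. *)
Lemma trvgen_bounded n :
  exists L, forall A : 'M[F]_n.+1, \det A = 1 -> trvgen L A.
Proof.
elim: n => [|n [L IH]].
  exists 0%N => A; rewrite det_mx11 => A1.
  have -> : A = 1%:M by apply/matrixP => i j; rewrite !ord1 A1 mxE.
  exact: Trvgen1.
exists (n.+2 + L + n.+2).+2.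
(* Block LDU factorization; [D] is the Schur complement of the corner and again has determinant
   1. *)
have corner (A : 'M[F]_n.+2) : A 0 0 = 1 -> \det A = 1 -> trvgen (n.+2 + L + n.+2) A.
  move=> A00 detA; pose A' : 'M[F]_(1 + n.+1) := A.
  pose c := dlsubmx A'; pose r := ursubmx A'; pose D := drsubmx A' - c *m r.
  have AE : A = block_mx 1%:M 0 c 1%:M *m block_mx 1%:M 0 0 D *m
      block_mx 1%:M r 0 1%:M :> 'M[F]_(1 + n.+1).
    rewrite !mulmx_block !(mul1mx, mulmx1, mul0mx, mulmx0, addr0, add0r).
    rewrite /D [c *m r + _]addrC subrK -[LHS](submxK A').
    congr block_mx; apply/matrixP => i j; rewrite !ord1 !mxE /= -[RHS]A00.
    by congr (A _ _); apply: val_inj.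
  rewrite AE; apply: trvgenM; last exact: trvgen_ublock.
  apply: trvgenM; first exact: trvgen_lblock.
  have dl (B : 'cV[F]_n.+1) C :
      \det (block_mx 1%:M 0 B C : 'M[F]_(1 + n.+1)) = \det C.
    by rewrite det_lblock det1 mul1r.
  have du (B : 'rV[F]_n.+1) : \det (block_mx 1%:M B 0 1%:M : 'M[F]_(1 + n.+1)) = 1.
    by rewrite det_ublock !det1 mul1r.
  apply/trvgen_lift/IH; move: detA; rewrite AE !det_mulmx.
  by rewrite du !dl det1 mul1r mulr1.
have offdiag (A : 'M[F]_n.+2) i : i != 0 -> A i 0 != 0 -> \det A = 1 ->
    trvgen (n.+2 + L + n.+2).+1 A.
  move=> i0 Ai detA; apply: (@trvgen_divl _ _ 0 i ((1 - A 0 0) / A i 0)).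
    by rewrite eq_sym.
  apply: corner; first by rewrite trvE eqxx mulr1n divfK// addrC subrK.
  by rewrite det_mulmx det_trv ?mul1r// eq_sym.
move=> A detA; have [[i [i0 Ai]]|] := pselect (exists i, i != 0 /\ A i 0 != 0).
  by apply: TrvgenW; exact: offdiag Ai detA.
move=> /forallNP colA.
have A00 : A 0 0 != 0.
  apply/eqP => A00; suff det0 : \det A = 0.
    by have := oner_neq0 F; rewrite -detA det0 eqxx.
  rewrite (expand_det_col A 0) big1// => i _.
  have [->|i0] := eqVneq i 0; first by rewrite A00 mul0r.
  have := colA i; case: (eqVneq (A i 0) 0) => [->|Ai []//].
  by rewrite mul0r.
have i10 : lift 0 0 != 0 :> 'I_n.+2 by [].
(* Only the corner of the first column is non-zero: adding the first row to the second leads back to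
   [offdiag]. *)
apply: (@trvgen_divl _ _ (lift 0 0) 0 1) => //.
apply: (offdiag _ (lift 0 0)) => //.
  rewrite trvE eqxx mulr1n mul1r.
  have := colA (lift 0 0); case: (eqVneq (A (lift 0 0) 0) 0) => [-> _|Ai []//].
  by rewrite add0r.
by rewrite det_mulmx det_trv ?mul1r.
Qed.

End Transvections.

(** * Real structure of a Hilbert space *)

Local Open Scope classical_set_scope.

Section Realification.
Context {R : realType}.

Lemma complex_ge0_real (z : R[i]) : 0 <= z -> (complex.Re z)%:C%C = z.
Proof. by move=> z0; rewrite RRe_real// ger0_real. Qed.

(** A separate type, so that the real scaling does not compete with the complex one on [H]. *)
Definition realified (H : hilbertType R) : Type := H.

HB.instance Definition _ (H : hilbertType R) := GRing.Zmodule.on (realified H).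

Variable H : hilbertType R.
Local Notation V := (realified H).

Definition realified_scale (a : R) (x : V) : V := (a%:C%C : R[i]) *: (x : H).

Fact realified_scaleA a b x :
  realified_scale a (realified_scale b x) = realified_scale (a * b) x.
Proof. by rewrite /realified_scale scalerA -rmorphM. Qed.
Fact realified_scale1 : left_id 1 realified_scale.
Proof. by move=> x; rewrite /realified_scale rmorph1 scale1r. Qed.
Fact realified_scaleDr : right_distributive realified_scale +%R.
Proof. by move=> a x y; exact: scalerDr. Qed.
Fact realified_scaleDl x : {morph realified_scale^~ x : a b / a + b}.
Proof. by move=> a b; rewrite /realified_scale rmorphD scalerDl. Qed.

HB.instance Definition _ := GRing.Zmodule_isLmodule.Build R V
  realified_scaleA realified_scale1 realified_scaleDr realified_scaleDl.

(** The real part keeps the norm, hence completeness and isometries, and invariance of a vector does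
    not involve the scalars. *)
Definition rdot (x y : V) : R := complex.Re (hdot (x : H) y).

Lemma hnorm_complex (x : H) : (hnorm x)%:C%C = `|x|.
Proof. by rewrite complex_ge0_real. Qed.

Lemma hnorm_ge0 (x : H) : 0 <= hnorm x.
Proof. by rewrite -lecR hnorm_complex normr_ge0. Qed.

Lemma rdot_norm (x : H) : rdot x x = hnorm x ^+ 2.
Proof. by rewrite /rdot hdot_norm -hnorm_complex -rmorphXn. Qed.

Lemma rdotDl (x y z : V) : rdot (x + y) z = rdot x z + rdot y z.
Proof. by rewrite /rdot linearDl raddfD. Qed.

Lemma rdotZl a (x z : V) : rdot (a *: x) z = a * rdot x z.
Proof.
rewrite /rdot [hdot _ _]linearZl_LR /=; case: (hdot _ _) => b c /=.
by rewrite mul0r subr0.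
Qed.

Lemma rdotC (x y : V) : rdot x y = rdot y x.
Proof.
by rewrite /rdot hermC expr0 mul1r /=; case: (hdot _ _).
Qed.

Lemma rdot_ge0 (x : V) : 0 <= rdot x x.
Proof. by rewrite rdot_norm exprn_ge0// hnorm_ge0. Qed.

Lemma rdot_eq0 (x : V) : rdot x x = 0 -> x = 0.
Proof.
rewrite rdot_norm => /eqP; rewrite expf_eq0 /= => /eqP x0.
by apply/eqP; rewrite -normr_eq0 -hnorm_complex x0.
Qed.

Lemma norm_lt_rdot (x : H) (e : R[i]) : 0 < e ->
  (`|x| < e) = (rdot x x < complex.Re e ^+ 2).
Proof.
move=> e0; rewrite -[e in LHS]complex_ge0_real ?ltW// -hnorm_complex ltcR.
have e0' : 0 < complex.Re e by rewrite -ltcR complex_ge0_real ?ltW.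
by rewrite rdot_norm ltr_pXn2r// ?nnegrE ?hnorm_ge0 ?ltW.
Qed.

Lemma rdot_complete (u : nat -> V) :
  (forall e, 0 < e -> exists N, forall m n, (N <= m)%N -> (N <= n)%N ->
     rdot (u m - u n) (u m - u n) < e) ->
  exists l, forall e, 0 < e -> exists N, forall n, (N <= n)%N ->
     rdot (u n - l) (u n - l) < e.
Proof.
move=> uC; have ucvg : cvg ((u : nat -> H) @ \oo).
  apply: cauchy_cvg; apply/cauchy_exP => e e0.
  have e0' : 0 < complex.Re e by rewrite -ltcR complex_ge0_real ?ltW.
  have [|N NP] := uC (complex.Re e ^+ 2); first by rewrite exprn_gt0.
  exists (u N); exists N => // n /= Nn.
  by rewrite -ball_normE /= norm_lt_rdot// NP.
exists (lim ((u : nat -> H) @ \oo)) => e e0.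
have e0c : 0 < (Num.sqrt e)%:C%C :> R[i] by rewrite ltcR sqrtr_gt0.
have /cvgrPdist_lt/(_ _ e0c)[N _ NP] := ucvg.
exists N => n Nn; have := NP n Nn.
rewrite distrC norm_lt_rdot//= sqr_sqrtr//; exact: ltW.
Qed.

Definition real_form : hilbert_form V :=
  HilbertForm rdotDl rdotZl rdotC rdot_ge0 rdot_eq0 rdot_complete.

End Realification.

(** * The semidirect product *)

(* The circumcenter of a bounded orbit is fixed. *)
Lemma bounded_orbit_fixed_point (R : realType) (V : lmodType R)
    (ip : hilbert_form V) (I : Type) (i0 : I) (rho : I -> {linear V -> V}) x :
  (forall i y z, ip (rho i y) (rho i z) = ip y z) ->
  (forall i j, exists k, forall y, rho i y = rho j (rho k y)) ->
  rho i0 x = x -> sqn ip x = 1 ->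
  (forall i, sqn ip (rho i x - x) <= 4^-1) ->
  exists c, c != 0 /\ forall i, rho i c = c.
Proof.
move=> rho_ip rho_tr rho0 x1 rhox.
have rhoB i y z : sqn ip (rho i y - rho i z) = sqn ip (y - z).
  by rewrite -linearB; exact: rho_ip.
pose E : set R := [set s | exists y, forall i, sqn ip (rho i x - y) <= s].
have Elb : has_lbound E.
  by exists 0 => s [y ys]; apply: le_trans (ys i0); exact: sqn_ge0.
have E4 : E 4^-1 by exists x.
have Einf : has_inf E by split => //; exists 4^-1.
have r4 : inf E <= 4^-1 by exact: ge_inf.
have [d d0|d d' y dd' Pd i|e e0|c cP] := @cauchy_family_center _ _ ip
  (fun d y => forall i, sqn ip (rho i x - y) <= inf E + d).
- have [s [y ys] sd] := inf_adherent d0 Einf.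
  by exists y => i; apply: le_trans (ys i) (ltW sd).
- by apply: le_trans (Pd i) _; rewrite lerD2l.
(* By the parallelogram law the midpoint of two approximate centers saves a quarter of their squared
   distance. As [inf E] cannot be beaten, that squared distance is at most 4 e / 5. *)
- exists (e / 5); first by rewrite divr_gt0.
  move=> y z Py Pz; have : inf E <= inf E + e / 5 - sqn ip (y - z) / 4.
    apply: ge_inf => //; exists (2^-1 *: (y + z)) => i.
    have := Py i; have := Pz i.
    have -> : rho i x - 2^-1 *: (y + z) =
        2^-1 *: ((rho i x - y) + (rho i x - z)).
      rewrite addrACA -opprD scalerBr; congr (_ - _).
      by rewrite -mulr2n -[rho i x *+ 2]scaler_nat scalerA mulVf ?scale1r.
    rewrite sqnZ; have := parallelogram ip (rho i x - y) (rho i x - z).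
    have -> : rho i x - y - (rho i x - z) = - (y - z).
      by rewrite !opprB addrC subrKA.
    rewrite sqnN; move: (sqn ip (_ + _)) => s; lra.
  lra.
exists c; split.
  (* An approximate center [y] has squared distance at most 1/4 + 1/8 to [x] and less than 1/8 to
     [c]. Doubling and adding puts [c] at squared distance less than 1 from the unit vector [x]. *)
  apply/eqP => c0; have [|d d0 dP] := cP (8^-1); first by rewrite invr_gt0 ltr0n.
  have dd0 : 0 < Num.min d 8^-1 by rewrite lt_min d0 invr_gt0 ltr0n.
  have [s [y ys] sd] := inf_adherent dd0 Einf.
  have yd : inf E + Num.min d 8^-1 <= inf E + d by rewrite lerD2l ge_min lexx.
  have yd' : inf E + Num.min d 8^-1 <= inf E + 8^-1.
    by rewrite lerD2l ge_min lexx orbT.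
  have yc := dP y (fun i => le_trans (ys i) (le_trans (ltW sd) yd)).
  have := sqnB_trans ip y x c; have := ys i0.
  by rewrite rho0 c0 subr0 x1 -c0; lra.
move=> i; apply/eqP; rewrite -subr_eq0; apply/eqP/(hform_eq0 (h := ip)).
apply: le_anti; rewrite hform_ge0 andbT; apply/ler_addgt0Pr => e e0.
rewrite add0r -/(sqn ip _).
have [|d d0 dP] := cP (e / 4); first by rewrite divr_gt0.
have [s [y ys] sd] := inf_adherent d0 Einf.
have yd j := le_trans (ys j) (ltW sd).
have yc := dP y yd.
(* The orbit is permuted by [rho i], so the image of an approximate center is an approximate center
   of the same quality. *)
have iyc : sqn ip (rho i y - c) < e / 4.
  apply: dP => j; have [k jk] := rho_tr j i.
  by rewrite jk rhoB; exact: yd.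
apply: le_trans (sqnB_trans ip (rho i y) _ _) _.
rewrite rhoB [sqn ip (c - y)]sqnBC; move: (sqn _ _) (sqn _ _) yc iyc => *; lra.
Qed.

(** * Elementary elements and their relations *)

Section ElementaryElements.
Context {R : realType} {K : fieldType} (v : absolute_value R K) (n m : nat).
Local Notation F := (valued_field v).
Local Notation G := (SL_semidirect n m F).
Implicit Types (i k : 'I_n) (s : 'I_n + 'I_m) (b t : F).

(** The faithful block representation of the affine action; it turns every relation between
    elementary elements into one between transvections of size n + m. *)
Definition sd_mx (x : G) : 'M[F]_(n + m) :=
  block_mx (SL_val x.1) x.2 0 1%:M.

Lemma sd_mxM x y : sd_mx (x * y)%g = sd_mx x *m sd_mx y.
Proof.
by rewrite /sd_mx mulmx_block !(mulmx0, mulmx1, mul0mx, addr0, add0r) addrC.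
Qed.

Lemma sd_mx1 : sd_mx 1%g = 1%:M.
Proof. by rewrite /sd_mx -scalar_mx_block. Qed.

Lemma sd_mx_inj : injective sd_mx.
Proof.
move=> [g A] [h B] /eq_block_mx[/= gh AB _ _].
by congr pair => //; exact: val_inj.
Qed.

(** For [i = k] this is the identity, the default value of [insubd]. *)
Definition SL_trv i k b : SL n F := insubd (SL_one n F) (trv i k b).

Lemma SL_trvE i k b : i != k -> SL_val (SL_trv i k b) = trv i k b.
Proof. by move=> ik; apply: insubdK; rewrite -topredE /= det_trv. Qed.

(** [s] runs over the n + m columns of [sd_mx], so that transvections of SL_n and translations by
    matrices are treated alike. *)
Definition elem i s b : G :=
  match s with
  | inl j => (SL_trv i j b, 0)
  | inr j => (1%g, b *: delta_mx i j)
  end.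

Lemma elem_mx i s b : lshift m i != unsplit s ->
  sd_mx (elem i s b) = trv (lshift m i) (unsplit s) b.
Proof.
case: s => j /= ij; rewrite /sd_mx /= /trv scalar_mx_block.
  rewrite SL_trvE; last by rewrite -(inj_eq (@lshift_inj n m)).
  have -> : delta_mx (lshift m i) (lshift m j) =
      block_mx (delta_mx i j) 0 0 0 :> 'M[F]_(n + m).
    apply/matrixP => p q; rewrite -[p]fintype.splitK -[q]fintype.splitK.
    by case: (fintype.split p) => p'; case: (fintype.split q) => q' /=;
    rewrite ?block_mxEul ?block_mxEur ?block_mxEdl ?block_mxEdr !mxE
      ?eq_rlshift ?andbF ?(inj_eq (@lshift_inj _ _)) //.
  by rewrite scale_block_mx !scaler0 add_block_mx !addr0.
have -> : delta_mx (lshift m i) (rshift n j) =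
    block_mx 0 (delta_mx i j) 0 0 :> 'M[F]_(n + m).
  apply/matrixP => p q; rewrite -[p]fintype.splitK -[q]fintype.splitK.
  by case: (fintype.split p) => p'; case: (fintype.split q) => q' /=;
  rewrite ?block_mxEul ?block_mxEur ?block_mxEdl ?block_mxEdr !mxE
    ?eq_rlshift ?eq_lrshift ?andbF ?(inj_eq (@lshift_inj _ _))
    ?(inj_eq (@rshift_inj _ _)) //.
by rewrite scale_block_mx !scaler0 add_block_mx !addr0 add0r.
Qed.

Lemma elem0 i s : lshift m i != unsplit s -> elem i s 0 = 1%g.
Proof. by move=> is'; apply: sd_mx_inj; rewrite elem_mx// trv0 sd_mx1. Qed.

Lemma elemD i s b t : lshift m i != unsplit s ->
  elem i s (b + t) = (elem i s b * elem i s t)%g.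
Proof. by move=> is'; apply: sd_mx_inj; rewrite sd_mxM !elem_mx// trvD. Qed.

Lemma elem_comm_col i k s b t :
  lshift m i != unsplit s -> lshift m k != unsplit s ->
  (elem i s b * elem k s t = elem k s t * elem i s b)%g.
Proof.
move=> is' ks; apply: sd_mx_inj; rewrite !sd_mxM !elem_mx//.
by rewrite trv_comm// eq_sym.
Qed.

Lemma elem_comm_row i k s b t :
  i != k -> lshift m i != unsplit s ->
  (elem i (inl k) t * elem i s b = elem i s b * elem i (inl k) t)%g.
Proof.
move=> ik is'; have ik' : lshift m i != lshift m k.
  by rewrite (inj_eq (@lshift_inj _ _)).
apply: sd_mx_inj; rewrite !sd_mxM !elem_mx//.
by rewrite trv_comm// eq_sym.
Qed.

Lemma elem_braid i k s b t :
  i != k -> lshift m i != unsplit s -> lshift m k != unsplit s ->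
  (elem i (inl k) t * elem k s b =
   elem i s (t * b)%R * elem k s b * elem i (inl k) t)%g.
Proof.
move=> ik is' ks; have ik' : lshift m i != lshift m k.
  by rewrite (inj_eq (@lshift_inj _ _)).
by apply: sd_mx_inj; rewrite !sd_mxM !elem_mx// trv_braid.
Qed.

Lemma elem_cvg i s : lshift m i != unsplit s ->
  elem i s b @[b --> (0 : F)] --> (1%g : G).
Proof.
move=> is'; have F0 : Filter (nbhs (0 : F)) by exact: nbhs_filter.
apply: (sd_cvgP F0 (f := elem i s)).
  apply: (proj2 (mx_cvgP (fun b => SL_val (elem i s b).1) 1%:M)) => p q.
  case: s is' => j is' /=.
    have -> : (fun b : F => SL_val (SL_trv i j b) p q) =
        (fun b : F => (1%:M : 'M[F]_n) p q + b * (delta_mx i j : 'M[F]_n) p q).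
      apply/funext => b; rewrite SL_trvE; last first.
        by rewrite -(inj_eq (@lshift_inj n m)).
      by rewrite !mxE.
    rewrite -[X in _ --> X]addr0 -[X in _ --> _ + X](mul0r ((delta_mx i j : 'M[F]_n) p q)).
    apply: valued_field_cvgD; first exact: cvg_cst.
    by apply: valued_field_cvgM; [exact: cvg_id|exact: cvg_cst].
  exact: cvg_cst.
apply: (proj2 (mx_cvgP (fun b => (elem i s b).2 : 'M[F]_(n, m)) 0)) => p q.
case: s is' => j is' /=; first exact: cvg_cst.
rewrite mxE -[X in _ --> X](mul0r ((delta_mx i j : 'M[F]_(n, m)) p q)).
under eq_fun do rewrite mxE.
apply: (valued_field_cvgM F0 (f := fun b : F => b)
  (g := fun=> (delta_mx i j : 'M[F]_(n, m)) p q)); first exact: cvg_id.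
exact: cvg_cst.
Qed.

End ElementaryElements.

Section ShearMaps.
Context {F : fieldType}.
Local Notation W := (F^o * F^o)%type.

(** This and [shear_snd] are the effects of conjugation by the two elementary subgroups of SL_2 on
    the coordinates of [plane]. *)
Definition shear_fst (t : F) (w : W) : W := (w.1 + t * w.2, w.2).
Definition shear_snd (t : F) (w : W) : W := (w.1, w.2 + t * w.1).

Fact shear_fst_linear t : linear (shear_fst t).
Proof.
move=> a [x1 x2] [y1 y2]; rewrite /shear_fst /=; congr pair => /=.
by rewrite /GRing.scale /=; ring.
Qed.
Fact shear_snd_linear t : linear (shear_snd t).
Proof.
move=> a [x1 x2] [y1 y2]; rewrite /shear_snd /=; congr pair => /=.
by rewrite /GRing.scale /=; ring.
Qed.
HB.instance Definition _ t := GRing.isLinear.Build F W W _ (shear_fst t)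
  (shear_fst_linear t).
HB.instance Definition _ t := GRing.isLinear.Build F W W _ (shear_snd t)
  (shear_snd_linear t).

End ShearMaps.

(** * Planes of translations in a unitary representation *)

Section Representation.
Context {R : realType} {K : fieldType} (v : absolute_value R K) (n m : nat).
Local Notation F := (valued_field v).
Local Notation G := (SL_semidirect n m F).
Local Notation elem := (@elem R K v n m).

Definition valued_absval : absolute_value R F :=
  @AbsoluteValue R F v (absval_ge0 v) (absval_eq0 v) (absvalM v) (absvalD v).

(** If no absolute value exceeded 1, taking inverses would give every non-zero element absolute
    value 1, and balls of radius 1 would be points. *)
Lemma nondiscrete_absval_gt1 :
  ~ (forall A : set F, open A) -> exists t, 1 < valued_absval t.
Proof.
move=> ndisc; apply/not_existsP => le1; apply: ndisc => A.
have v1 (x : F) : x != 0 -> 1 <= valued_absval x.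
  move=> x0; have := le1 x^-1; move/negP; rewrite -leNgt => xV.
  have : valued_absval x * valued_absval x^-1 = 1.
    by rewrite -absvalM divff// absval1.
  by move=> <-; rewrite ler_piMr ?absval_ge0.
rewrite openE => x Ax; apply/nbhs_ballP; exists 1 => //= y.
rewrite ballEmdist /= /mdist /= /absdist => xy.
suff -> : y = x by [].
apply/eqP; rewrite eq_sym -subr_eq0; apply: contraTT xy => xy0.
by rewrite -leNgt; exact: (v1 _ xy0).
Qed.

Variables (H : hilbertType R) (pi : unitary_rep G H).
Local Notation V := (realified H).
Local Notation ip := (real_form H).

Definition real_rep (x : G) (y : V) : V := pi x y.

Fact real_rep_linear x : linear (real_rep x).
Proof.
by move=> a y z; rewrite /real_rep linearD /= [pi x (_ *: _)]linearZ.
Qed.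
HB.instance Definition _ x := GRing.isLinear.Build R V V _ (real_rep x)
  (real_rep_linear x).

Lemma real_repM x y z : real_rep (x * y)%g z = real_rep x (real_rep y z).
Proof. exact: repM. Qed.

Lemma real_rep1 z : real_rep 1%g z = z.
Proof. exact: rep1. Qed.

Lemma real_rep_ip x y z : ip (real_rep x y) (real_rep x z) = ip y z.
Proof.
by have [_ h] := rep_unitary pi x; rewrite /real_form /= /rdot /real_rep h.
Qed.

Lemma sqn_hnorm (y : H) : sqn ip y = hnorm y ^+ 2.
Proof. exact: rdot_norm. Qed.

Lemma real_rep_continuous (f : F -> G) x :
  f b @[b --> (0 : F)] --> (1%g : G) ->
  forall k, 0 < k -> exists2 r, 0 < r &
    forall b, valued_absval b < r -> sqn ip (x - real_rep (f b) x) <= k.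
Proof.
move=> f1 k k0.
have fx : (pi (f b) x : H) @[b --> (0 : F)] --> (x : H).
  rewrite -[X in _ --> X](rep1 pi).
  have pi1 : (fun g : G => pi g x : H) @ (1%g : G) --> (pi 1%g x : H).
    exact: rep_continuous.
  exact: (cvg_comp _ _ f1 pi1).
have k0c : 0 < (Num.sqrt k)%:C%C :> R[i] by rewrite ltcR sqrtr_gt0.
have /cvgrPdist_lt/(_ _ k0c)/nbhs_ballP[r /= r0 rP] := fx.
exists r => // b br; have : ball (0 : F) r b.
  by rewrite ballEmdist /= /mdist /= /absdist sub0r absvalN.
move=> /rP /=; rewrite norm_lt_rdot//= sqr_sqrtr ?(ltW k0)//.
exact: ltW.
Qed.

Section Plane.
Variables (i k : 'I_n) (s : 'I_n + 'I_m).
Hypotheses (ik : i != k) (is' : lshift m i != unsplit s)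
  (ks : lshift m k != unsplit s).
Local Notation W := (F^o * F^o)%type.

(** Rows [i] and [k] of one column commute; with the shears between these rows they realize the
    action of SL_2 on K^2, whether the column lies in SL_n or in the matrix part. *)
Definition plane (w : W) : G := (elem i s w.1 * elem k s w.2)%g.

Lemma planeD w w' : plane (w + w') = (plane w * plane w')%g.
Proof.
rewrite /plane /= !elemD// !mulgA; congr (_ * _)%g.
rewrite -!mulgA; congr (_ * _)%g; exact: elem_comm_col.
Qed.

Fact plane_rep0 y : real_rep (plane 0) y = y.
Proof. by rewrite /plane /= !elem0// mulg1 real_rep1. Qed.
Fact plane_repD w w' y :
  real_rep (plane (w + w')) y = real_rep (plane w) (real_rep (plane w') y).
Proof. by rewrite planeD real_repM. Qed.

Definition plane_family : unitary_family ip W :=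
  UnitaryFamily (ufam := fun w => real_rep (plane w)) plane_rep0 plane_repD
    (fun w => real_rep_ip (plane w)).

Lemma plane_shear_fst t w :
  (elem i (inl k) t * plane w = plane (shear_fst t w) * elem i (inl k) t)%g.
Proof.
rewrite /plane /= mulgA elem_comm_row// -mulgA elem_braid// !mulgA elemD//.
Qed.

Lemma plane_shear_snd t w :
  (elem k (inl i) t * plane w = plane (shear_snd t w) * elem k (inl i) t)%g.
Proof.
have ki : k != i by rewrite eq_sym.
rewrite /plane /= mulgA elem_braid// -!mulgA elem_comm_row//.
rewrite addrC elemD// !mulgA; do 2 congr (_ * _)%g.
exact: elem_comm_col.
Qed.

Lemma elem_almost_fixed N lam x d : (0 < N)%N -> 1 < valued_absval lam ->
  (forall l : nat, valued_absval l%:R <= 1) \/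
    (exists2 l, (8 * N ^ 2 <= l)%N & lam = l%:R) ->
  sqn ip x = 1 ->
  (forall p q l, p != q -> (l < N)%N ->
     sqn ip (real_rep (elem p (inl q) (lam ^+ l)) x - x) <= d) ->
  forall b, sqn ip (real_rep (elem i s b) x - x) <= 32 / N%:R + 16 * d.
Proof.
move=> N0 lam1 lamP x1 xd b.
have plane1 (c : F) : plane (c *: ((1, 0) : W)) = elem i s c.
  by rewrite /plane /= /GRing.scale /= mulr1 mulr0 elem0// mulg1.
have plane2 (c : F) : plane (c *: ((0, 1) : W)) = elem k s c.
  by rewrite /plane /= /GRing.scale /= mulr1 mulr0 elem0// mul1g.
rewrite sqnBC -plane1.
apply: (line_almost_fixed N0 lam1 lamP (U := plane_family) (e2 := (0, 1) : W)
  (J := fun l => real_rep (elem i (inl k) (lam ^+ l)))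
  (J' := fun l => real_rep (elem k (inl i) (lam ^+ l)))
  (g := fun l => shear_fst (lam ^+ l)) (g' := fun l => shear_snd (lam ^+ l))) => //.
- by move=> l y z; exact: real_rep_ip.
- by move=> l y z; exact: real_rep_ip.
- by move=> l w y; rewrite /= -!real_repM plane_shear_fst.
- by move=> l w y; rewrite /= -!real_repM plane_shear_snd.
- by move=> l; rewrite /= /shear_fst /= mulr0 addr0.
- move=> l; rewrite /= /shear_fst /=; congr pair.
  by rewrite -[RHS]/(1 + lam ^+ l * 0 : F) mulr0 addr0.
- by move=> l; rewrite /= /shear_snd /= mulr0 addr0.
- move=> l; rewrite /= /shear_snd /=; congr pair.
  by rewrite -[RHS]/(1 + lam ^+ l * 0 : F) mulr0 addr0.
- by move=> l lN; apply: xd.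
- by move=> l lN; apply: xd; rewrite // eq_sym.
move=> e e0.
have [r1 r10 r1P] := real_rep_continuous x (elem_cvg (v := v) is') e0.
have [r2 r20 r2P] := real_rep_continuous x (elem_cvg (v := v) ks) e0.
exists (Num.min r1 r2); first by rewrite lt_min r10.
move=> c; rewrite lt_min => /andP[c1 c2]; rewrite /= plane1 plane2.
by split; [exact: r1P|exact: r2P].
Qed.

End Plane.

(** The second row of a plane must avoid both the given row and the given column; this is where n >=
    3 enters. *)
Lemma exists_third (i j : 'I_n) : (3 <= n)%N -> exists k, (k != i) && (k != j).
Proof.
move=> n3; apply/existsP; apply: contraT => /existsPn all2.
have : (#|'I_n| <= #|pred2 i j|)%N.
  apply: subset_leq_card; apply/fintype.subsetP => k _; rewrite !inE.
  by have := all2 k; rewrite negb_and !negbK.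
by rewrite card_ord card2 leqNgt (leq_ltn_trans _ n3)//; case: (_ != _).
Qed.

(** * From elementary subgroups to the whole group *)

Section BoundedDisplacement.
Variables (x : V) (h : R).
Hypothesis h0 : 0 <= h.
Local Notation disp g := (sqn ip (real_rep g x - x)).
Hypothesis elem_disp : forall i s b, lshift m i != unsplit s ->
  disp (elem i s b) <= h.

Lemma dispM y z : disp (y * z)%g <= 2 * disp y + 2 * disp z.
Proof.
rewrite real_repM; apply: le_trans (sqnB_trans ip (real_rep y x) _ _) _.
by rewrite -linearB [sqn ip (real_rep y _)]real_rep_ip addrC.
Qed.

(** By [dispM] one more generator turns 4^l h into at most 2 h + 2 (4^l h), which is at most 4^(l+1)
    h. *)
Lemma trvgen_disp l A (g : SL n F) : trvgen l A -> SL_val g = A ->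
  disp ((g, 0) : G) <= 4 ^+ l * h.
Proof.
move=> Al; elim: Al g => {l A} [|l A _ IH|l i j b A ij Al IH] g gA.
- have -> : ((g, 0) : G) = 1%g by congr pair; exact: val_inj.
  by rewrite real_rep1 subrr /sqn ip0l expr0 mul1r.
- apply: le_trans (IH g gA) _; rewrite ler_wpM2r// exprS ler_peMl ?exprn_ge0//.
  by rewrite ler1n.
have detA : \det A == 1.
  have := SL_det g; rewrite gA det_mulmx det_trv// mul1r.
  by move=> ->.
have -> : ((g, 0) : G) = (elem i (inl j) b * ((MkSL detA, 0) : G))%g.
  apply: (@sd_mx_inj _ _ v); rewrite sd_mxM /sd_mx /= SL_trvE// gA.
  by rewrite mulmx_block !(mulmx0, mulmx1, mul0mx, addr0, add0r).
apply: le_trans (dispM _ _) _.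
have hi := elem_disp (s := inl j) b (i := i).
have {}hi : disp (elem i (inl j) b) <= h.
  by apply: hi; rewrite (inj_eq (@lshift_inj _ _)).
have hA := IH (MkSL detA) erefl.
have p1 : h <= 4 ^+ l * h by rewrite ler_peMl// exprn_ege1// ler1n.
rewrite exprS; lra.
Qed.

Lemma translation_disp (A : 'M[F]_(n, m)) :
  disp ((1%g, A) : G) <= 4 ^+ (n * m) * h.
Proof.
have -> : A = \sum_(p <- enum {: 'I_n * 'I_m}) A p.1 p.2 *: delta_mx p.1 p.2.
  rewrite big_enum /= {1}[A]matrix_sum_delta pair_big /=.
  done.
have <- : size (enum {: 'I_n * 'I_m}) = (n * m)%N.
  by rewrite -cardE card_prod !card_ord.
elim: (enum _) => [|p r IH].
  rewrite big_nil -[(1%g, 0)]/(1%g : G) real_rep1 subrr /sqn ip0l expr0.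
  by rewrite mul1r.
rewrite big_cons; set B := \sum_(_ <- r) _ in IH *.
have -> : ((1%g, A p.1 p.2 *: delta_mx p.1 p.2 + B) : G) =
    (elem p.1 (inr p.2) (A p.1 p.2) * ((1%g, B) : G))%g.
  by congr pair; rewrite /= ?mulg1// mul1mx.
apply: le_trans (dispM _ _) _.
have hi : disp (elem p.1 (inr p.2) (A p.1 p.2)) <= h.
  by apply: elem_disp; rewrite /= eq_lrshift.
have p1 : h <= 4 ^+ size r * h by rewrite ler_peMl// exprn_ege1// ler1n.
rewrite exprS; lra.
Qed.

Lemma bounded_disp L : (forall A : 'M[F]_n, \det A = 1 -> trvgen L A) ->
  forall g : G, disp g <= 4 ^+ (L + n * m).+1 * h.
Proof.
move=> LP [g A].
have -> : ((g, A) : G) = (((1%g, A) : G) * ((g, 0) : G))%g.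
  by congr pair; rewrite /= ?mul1g// mulmx0 addr0.
apply: le_trans (dispM _ _) _.
have h1 := translation_disp A.
have h2 := trvgen_disp (LP _ (SL_det g)) erefl.
have p1 k : 1 <= 4 ^+ k :> R by rewrite exprn_ege1// ler1n.
have e1 : 4 ^+ (n * m) * h <= 4 ^+ (L + n * m) * h.
  by rewrite ler_wpM2r// exprD ler_peMl// exprn_ge0.
have e2 : 4 ^+ L * h <= 4 ^+ (L + n * m) * h.
  by rewrite ler_wpM2r// exprD ler_peMr// exprn_ge0.
rewrite exprS; lra.
Qed.

End BoundedDisplacement.

(** [sup] dominates the elements of a set that is bounded above, here by [2 * hnorm xi]. For
    [xi = 0] the strict inequality would give a negative supremum to a set containing 0. *)
Lemma Qeps_invariant_bound (Q : set G) eps (xi : H) q : 0 < eps -> Q q ->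
  Qeps_invariant pi Q eps xi ->
  xi != 0 /\ (forall g, Q g -> hnorm (pi g xi - xi) <= eps * hnorm xi).
Proof.
move=> e0 Qq xiQ.
have repn g : hnorm (pi g xi) = hnorm xi.
  apply/eqP; rewrite -(@eqrXn2 _ 2) ?hnorm_ge0// -!rdot_norm.
  by apply/eqP; exact: real_rep_ip.
have ub : has_ubound [set hnorm (pi g xi - xi) | g in Q].
  exists (2 * hnorm xi) => _ [g _ <-].
  rewrite -lecR hnorm_complex; apply: le_trans (ler_normB _ _) _.
  by rewrite -!hnorm_complex repn -rmorphD lecR mulr_natl mulr2n.
have le_eps g : Q g -> hnorm (pi g xi - xi) <= eps * hnorm xi.
  move=> Qg; apply: le_trans (ltW xiQ).
  by apply: ub_le_sup => //; exists g.
split => //; apply: contraTneq xiQ => xi0; rewrite -leNgt.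
have n0 : hnorm (0 : H) = 0 by rewrite /hnorm normr0.
rewrite xi0 n0 mulr0 -[X in X <= _](n0); apply: ub_le_sup; rewrite -?xi0//.
by exists q; rewrite // xi0 linear0 subrr.
Qed.

End Representation.

(** * The Kazhdan pair *)

Theorem theorem9 (R : realType) (K : fieldType) (v : absolute_value R K)
    (n m : nat) :
  local_field v -> (3 <= n)%N ->
  property_T R (SL_semidirect n m (valued_field v)).
Proof.
move=> [_ nd] n3.
have [L LP] : exists L, forall A : 'M[valued_field v]_n, \det A = 1 -> trvgen L A.
  by case: n n3 => // n' _; exact: trvgen_bounded.
(* [C] is the loss in [bounded_disp]. With N = 256 C and eps = 1 / (128 C), the total C (32 / N + 16
   eps) is 1/8 + 1/8, the 1/4 allowed by [bounded_orbit_fixed_point]. *)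
pose C := (4 ^ (L + n * m).+1)%N; pose N := (256 * C)%N.
have C0 : (0 < C)%N by rewrite expn_gt0.
have N0 : (0 < N)%N by rewrite muln_gt0.
have [lam lam1 lamP] := expanding_scale (8 * N ^ 2)%N (nondiscrete_absval_gt1 nd).
pose eps : R := (128 * C%:R)^-1.
have CR : 1 <= C%:R :> R by rewrite ler1n.
have eps0 : 0 < eps by rewrite invr_gt0 mulr_gt0// ltr0n.
have eps1 : eps <= 1 by rewrite invf_le1 ?mulr_gt0 ?ltr0n//; lra.
(* The compact set is finite: powers of [lam] below [N] in the elementary subgroups of SL_n. Equal
   indices only contribute the identity. *)
pose q (z : 'I_n * 'I_n * 'I_N) : SL_semidirect n m (valued_field v) :=
  elem (v := v) z.1.1 (inl z.1.2) (lam ^+ z.2).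
exists (range q), eps; split => //.
  by apply: finite_compact; apply: finite_image; exact: finite_finset.
move=> H pi [xi xiQ].
pose i0 : 'I_n := Ordinal (ltnW (ltnW n3)).
have [|xi0 xid] := Qeps_invariant_bound (q := q (i0, i0, Ordinal N0)) eps0 _ xiQ.
  by exists (i0, i0, Ordinal N0).
pose hx := hnorm xi.
have hx0 : 0 < hx.
  rewrite lt_def hnorm_ge0 andbT; apply: contraNneq xi0 => hx0.
  by rewrite -normr_eq0 -hnorm_complex -/hx hx0.
pose x : realified H := hx^-1 *: (xi : realified H).
have x1 : sqn (real_form H) x = 1.
  by rewrite sqnZ sqn_hnorm -exprMn mulVf ?expr1n// gt_eqF.
have xd (i j : 'I_n) l : i != j -> (l < N)%N ->
    sqn (real_form H) (real_rep pi (elem (v := v) i (inl j) (lam ^+ l)) x - x) <= eps.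
  move=> ij lN; set g := elem _ _ _.
  have -> : real_rep pi g x - x = hx^-1 *: (real_rep pi g xi - xi : realified H).
    by rewrite /x linearZ scalerBr.
  rewrite sqnZ sqn_hnorm -exprMn.
  (* Invariance bounds norms while [d] bounds squared norms; as [eps <= 1], the square is at most
     [eps]. *)
  apply: le_trans (_ : eps ^+ 2 <= _); last by rewrite expr2 ler_piMl// ltW.
  apply: lerXn2r; rewrite ?nnegrE ?mulr_ge0 ?invr_ge0 ?hnorm_ge0 ?(ltW eps0)//.
  rewrite mulrC ler_pdivrMr//; apply: xid.
  by exists (i, j, Ordinal lN).
pose h := 32 / N%:R + 16 * eps.
have h0 : 0 <= h by rewrite addr_ge0// ?divr_ge0// mulr_ge0// ltW.
have elemd i s b : lshift m i != unsplit s ->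
    sqn (real_form H) (real_rep pi (elem (v := v) i s b) x - x) <= h.
  (* If [s] is a column of the matrix part, no row meets it and only k != i is required, so [j] is
     set to [i]. *)
  move=> is'; pose j := if s is inl j then j else i.
  have [k /andP[ki kj]] := exists_third i j n3.
  have ks : lshift m k != unsplit s.
    case: s @j is' kj => j /= _ kj; last by rewrite eq_lrshift.
    by rewrite (inj_eq (@lshift_inj _ _)).
  apply: (elem_almost_fixed (k := k) _ is' ks N0 lam1 lamP x1 xd).
  by rewrite eq_sym.
have xall g : sqn (real_form H) (real_rep pi g x - x) <= 4^-1.
  apply: le_trans (bounded_disp h0 elemd LP g) _.
  rewrite -natrX -/C /h /eps /N natrM.
  have -> : C%:R * (32 / (256 * C%:R) + 16 / (128 * C%:R)) = 4^-1 :> R.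
    by field; rewrite gt_eqF// (lt_le_trans _ CR).
  by [].
have tr g g' : exists k, forall y,
    real_rep pi g y = real_rep pi g' (real_rep pi k y).
  by exists (g'^-1 * g)%g => y; rewrite -real_repM mulgA mulgV mul1g.
have [c [c0 cinv]] := bounded_orbit_fixed_point (ip := real_form H)
  (rho := fun g => real_rep pi g) (i0 := 1%g) (real_rep_ip pi)
  tr (real_rep1 pi x) x1 xall.
by exists c.
Qed.
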